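(* Let $\beta_0<\beta_2<\beta_1$ and $n\ge 1$. If $\beta_2>\tilde d_n(\beta_1)$, then the shape process $H^k$ (with parameter $\beta$) is ergodic for every $2\le k\le n+2$.
   Context: For $m\ge1$ and $\beta=(\beta_0,\beta_1,\beta_2)\in(0,\infty)^3$: for $x\in\mathbb{N}^m$, with zero boundary convention $x(0)=x(m+1)=0$, let $V_j(x)=\mathbf 1_{\{x(j-1)>x(j)\}}+\mathbf 1_{\{x(j+1)>x(j)\}}$. The crystal process $X^m$ with parameter $\beta$ is the continuous-time Markov chain on $\mathbb{N}^m$ jumping from $x$ to $x+e_j$ at rate $\beta_{V_j(x)}$, no other transitions; its shape process is $H^m_t=(X^m_t(1)-X^m_t(2),\dots,X^m_t(m-1)-X^m_t(m))\in\mathbb{Z}^{m-1}$, a Markov chain; ''ergodic'' means positive recurrent. $\tilde X^m$ denotes the crystal process with $m$ sites and parameter $(\tilde\beta_0,\tilde\beta_1,\tilde\beta_2)=(\beta_0,\beta_1,\beta_1)$, and $\mathbb{P}_{\mathbf 0}$ the law from the zero configuration. For $\beta_1>\beta_0$ define $\tilde d_m(\beta_1)=\inf\{d>0:\ \exists C,\alpha>0,\ \forall t\ge0,\ \mathbb{P}_{\mathbf 0}(\tilde X^m_t(m)\ge dt)\le Ce^{-\alpha t}\}$. *)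

(* Defs.v *)
From Stdlib Require Import Reals Arith List.
Open Scope R_scope.

(** Configurations of the crystal process with m sites: x : nat -> nat,
    only the values x 1, ..., x m are meaningful. *)
Definition config := nat -> nat.

Definition zero_config : config := fun _ => 0%nat.

Definition xb (m : nat) (x : config) (j : nat) : nat :=
  if andb (Nat.leb 1 j) (Nat.leb j m) then x j else 0%nat.

Definition V (m : nat) (x : config) (j : nat) : nat :=
  ((if Nat.ltb (xb m x j) (xb m x (j - 1)) then 1 else 0) +
   (if Nat.ltb (xb m x j) (xb m x (j + 1)) then 1 else 0))%nat.

Definition beta_of (b0 b1 b2 : R) (v : nat) : R :=
  match v with 0%nat => b0 | 1%nat => b1 | _ => b2 end.

Definition rate (b0 b1 b2 : R) (m : nat) (x : config) (j : nat) : R :=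
  beta_of b0 b1 b2 (V m x j).

Definition incr (x : config) (j : nat) : config :=
  fun i => if Nat.eqb i j then S (x i) else x i.

Definition sites (m : nat) : list nat := seq 1 m.

Definition total_rate (b0 b1 b2 : R) (m : nat) (x : config) : R :=
  fold_right (fun j acc => rate b0 b1 b2 m x j + acc) 0 (sites m).

(** uniformization constant: bounds the total jump rate out of any state *)
Definition unif (b0 b1 b2 : R) (m : nat) : R := INR m * (b0 + b1 + b2).

(** Sub-probability distributions with finite support, as weighted lists. *)
Definition dist := list (R * config).

Definition ustep (b0 b1 b2 : R) (m : nat) (d : dist) : dist :=
  flat_map (fun p : R * config =>
     let (w, x) := p in
     (w * (1 - total_rate b0 b1 b2 m x / unif b0 b1 b2 m), x) ::
     map (fun j => (w * (rate b0 b1 b2 m x j / unif b0 b1 b2 m), incr x j))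
         (sites m)) d.

Definition mass_of (E : config -> bool) (d : dist) : R :=
  fold_right (fun (p : R * config) acc => if E (snd p) then fst p + acc else acc) 0 d.

Definition total_mass (d : dist) : R :=
  fold_right (fun (p : R * config) acc => fst p + acc) 0 d.

Definition udist (b0 b1 b2 : R) (m n : nat) : dist :=
  Nat.iter n (ustep b0 b1 b2 m) ((1, zero_config) :: nil).

Definition poisson (lam t : R) (n : nat) : R :=
  exp (- (lam * t)) * (lam * t) ^ n / INR (fact n).

(** [crystal_prob b0 b1 b2 m t E p] : under P_0, the crystal process X^m
    with parameter (b0,b1,b2) satisfies P_0(X^m_t \in E) = p.
    (Uniformization: P_t = sum_n Poisson(lam t)(n) K^n.) *)
Definition crystal_prob (b0 b1 b2 : R) (m : nat) (t : R)
    (E : config -> bool) (p : R) : Prop :=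
  infinite_sum
    (fun n => poisson (unif b0 b1 b2 m) t n * mass_of E (udist b0 b1 b2 m n)) p.

Definition last_ge (m : nat) (d t : R) (x : config) : bool :=
  if Rle_dec (d * t) (INR (x m)) then true else false.

(** the set whose infimum is \tilde d_m(beta_1): tilde X^m has parameter
    (b0, b1, b1) *)
Definition tilde_D (m : nat) (b0 b1 : R) (d : R) : Prop :=
  d > 0 /\
  exists C alpha : R, C > 0 /\ alpha > 0 /\
    forall t : R, t >= 0 ->
      exists p, crystal_prob b0 b1 b1 m t (last_ge m d t) p /\
                p <= C * exp (- (alpha * t)).

Definition is_glb (S : R -> Prop) (l : R) : Prop :=
  (forall x, S x -> l <= x) /\ (forall y, (forall x, S x -> y <= x) -> y <= l).

(** shape H^k(x) = 0 iff x(1) = ... = x(k) *)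
Definition flat (k : nat) (x : config) : bool :=
  forallb (fun i => Nat.eqb (x i) (x (S i))) (seq 1 (k - 1)).

Definition kstep (b0 b1 b2 : R) (k : nat) (d : dist) : dist :=
  filter (fun p : R * config => negb (flat k (snd p))) (ustep b0 b1 b2 k d).

(** P(tau > n), tau = first return time (n >= 1) of the uniformized shape
    chain to the zero shape, started from the zero configuration *)
Definition survival (b0 b1 b2 : R) (k n : nat) : R :=
  total_mass (Nat.iter n (kstep b0 b1 b2 k) ((1, zero_config) :: nil)).

(** ergodic (positive recurrent) shape process H^k: the expected return
    time E[tau] = sum_n P(tau > n) to the zero shape is finite *)
Definition shape_ergodic (b0 b1 b2 : R) (k : nat) : Prop :=
  exists s, infinite_sum (fun n => survival b0 b1 b2 k n) s.

(* Main.v *)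
(** Let [M] and [m] be the largest and smallest heights. A fixed number of steps decreases
    the range [M - m] on average once it is large, so Foster's criterion applies. Every site
    with a higher neighbour moves at rate at least [b2], and following neighbours away from a
    highest site shows that all low sites rise at speed about [b2]. A low site separates the
    others into blocks that do not feel it, and a block of at most [n] sites is dominated by
    the attractive process with parameter [(b0, b1, b1)], whose maximum grows slower than
    [b2]. If only an end site is low, the remaining block may have [n + 1] sites, but that
    end site rises at rate [b1], faster than any maximum. Speeds are compared through
    functions with controlled drift: logarithms of exponential sums and an averaged maximum. *)

Require Import Defs.
From Stdlib Require Import Reals.
From Stdlib Require Import Arith List Lia Lra Classical FunctionalExtensionality.
Open Scope R_scope.

(** * Finite sums and uniformized jump kernels *)

(** The obstacle is that the crystal is not attractive: as [b2 < b1], raising a second neighbour of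
    a site can slow that site down. Two crystals cannot be ordered by a coupling, so the proof works
    with drifts of functions of one configuration and compares only generators, block by block, with
    those of the attractive process. The hypothesis on the speed concerns the last site, at
    continuous times, through a tail probability. What the blocks need is the expected maximum after
    one fixed number of steps. The change of clock is paid for by monotonicity in the number of
    steps, and the passage from the last site to the maximum by a second moment of the range that
    grows only linearly. Drift bounds are required only on configurations reachable in [T] steps.
    From a range much larger than [T], the division into low and high sites made at the start stays
    valid for all these steps, so the comparison functions may depend on the initial
    configuration. *)

Definition lsum {A : Type} (l : list A) (f : A -> R) : R :=
  fold_right (fun a acc => f a + acc) 0 l.

Lemma lsum_ext {A} (l : list A) f g :
  (forall a, In a l -> f a = g a) -> lsum l f = lsum l g.
Proof.
  induction l as [|a l IH]; simpl; intros H; [easy|].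
  rewrite H, IH by auto; easy.
Qed.

Lemma lsum_le {A} (l : list A) f g :
  (forall a, In a l -> f a <= g a) -> lsum l f <= lsum l g.
Proof.
  induction l as [|a l IH]; simpl; intros H; [lra|].
  apply Rplus_le_compat; auto.
Qed.

Lemma lsum_plus {A} (l : list A) f g :
  lsum l (fun a => f a + g a) = lsum l f + lsum l g.
Proof. induction l as [|a l IH]; simpl; lra. Qed.

Lemma lsum_scal {A} (l : list A) c f :
  lsum l (fun a => c * f a) = c * lsum l f.
Proof. induction l as [|a l IH]; simpl; lra. Qed.

Lemma lsum_const {A} (l : list A) c : lsum l (fun _ => c) = INR (length l) * c.
Proof.
  induction l as [|a l IH]; [simpl; lra|].
  simpl length; rewrite S_INR; simpl; lra.
Qed.

Lemma lsum_app {A} (l l' : list A) f : lsum (l ++ l') f = lsum l f + lsum l' f.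
Proof. induction l as [|a l IH]; simpl; lra. Qed.

Lemma lsum_swap {A B} (l : list A) (l' : list B) f :
  lsum l (fun a => lsum l' (fun b => f a b)) = lsum l' (fun b => lsum l (fun a => f a b)).
Proof.
  induction l as [|a l IH]; simpl.
  - rewrite lsum_const; lra.
  - rewrite IH, lsum_plus; easy.
Qed.

Lemma lsum_map {A B} (h : A -> B) l f : lsum (map h l) f = lsum l (fun a => f (h a)).
Proof. induction l as [|a l IH]; simpl; congruence. Qed.

Lemma lsum_flat_map {A B} (h : A -> list B) l f :
  lsum (flat_map h l) f = lsum l (fun a => lsum (h a) f).
Proof. induction l as [|a l IH]; simpl; [easy|]. rewrite lsum_app, IH; easy. Qed.

Lemma lsum_filter {A} (P : A -> bool) l f :
  lsum (filter P l) f = lsum l (fun a => if P a then f a else 0).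
Proof.
  induction l as [|a l IH]; simpl; [easy|].
  destruct (P a); simpl; lra.
Qed.

Lemma lsum_nonneg {A} (l : list A) f : (forall a, In a l -> 0 <= f a) -> 0 <= lsum l f.
Proof.
  intros H. replace 0 with (lsum l (fun _ => 0)) by (rewrite lsum_const; lra).
  now apply lsum_le.
Qed.

Lemma lsum_ge_term {A} (l : list A) f a :
  (forall a, In a l -> 0 <= f a) -> In a l -> f a <= lsum l f.
Proof.
  induction l as [|b l IH]; [easy|]. simpl; intros H [->|Ha].
  - assert (0 <= lsum l f) by (apply lsum_nonneg; auto). lra.
  - assert (0 <= f b) by auto. assert (f a <= lsum l f) by auto. lra.
Qed.

Lemma lsum_le_const {A} (l : list A) f c :
  (forall a, In a l -> f a <= c) -> lsum l f <= INR (length l) * c.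
Proof. intros H. rewrite <- lsum_const. now apply lsum_le. Qed.

Lemma lsum_seq_shift o l f : lsum (seq (S o) l) f = lsum (seq 1 l) (fun i => f (o + i)%nat).
Proof.
  rewrite <- (lsum_map (Nat.add o)). f_equal.
  replace (S o) with (o + 1)%nat by lia.
  generalize 1%nat as a. induction l as [|l IH]; intros a; simpl; [easy|].
  specialize (IH (S a)). rewrite Nat.add_succ_r in IH. now rewrite IH.
Qed.

Lemma lsum_update (l : list nat) (f g : nat -> R) j :
  NoDup l -> In j l -> (forall i, i <> j -> g i = f i) ->
  lsum l g = lsum l f + (g j - f j).
Proof.
  induction l as [|a l IH]; intros Hl Hj H; [easy|].
  inversion_clear Hl as [|? ? Ha Hnd]. simpl in *.
  destruct Hj as [->|Hj].
  - rewrite (lsum_ext l g f); [lra|].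
    intros i Hi; apply H; congruence.
  - rewrite (IH Hnd Hj H), (H a); [lra|]. congruence.
Qed.

Lemma in_sites m j : In j (sites m) <-> (1 <= j <= m)%nat.
Proof. unfold sites. rewrite in_seq. lia. Qed.

Lemma length_sites m : length (sites m) = m.
Proof. apply length_seq. Qed.

Lemma incr_same x j : incr x j j = S (x j).
Proof. unfold incr. now rewrite Nat.eqb_refl. Qed.

Lemma incr_other x j i : i <> j -> incr x j i = x i.
Proof. intros H. unfold incr. now apply Nat.eqb_neq in H as ->. Qed.

Lemma incr_bounds x j i : (x i <= incr x j i <= x i + 1)%nat.
Proof. unfold incr. destruct (Nat.eqb i j); lia. Qed.

Definition gen (m : nat) (r : config -> nat -> R) (f : config -> R) (x : config) : R :=
  lsum (sites m) (fun j => r x j * (f (incr x j) - f x)).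

(** One step of the chain uniformized at rate [Lam], acting on functions. Written as the identity
    plus [gen / Lam], it turns a drift bound directly into a bound on one step. *)
Definition kern (Lam : R) (m : nat) (r : config -> nat -> R) (f : config -> R)
    (x : config) : R :=
  f x + gen m r f x / Lam.

Definition iterk Lam m r N f : config -> R := Nat.iter N (kern Lam m r) f.

Definition uniformizable (Lam : R) (m : nat) (r : config -> nat -> R) : Prop :=
  0 < Lam /\ (forall x j, 0 <= r x j) /\ (forall x, lsum (sites m) (r x) <= Lam).

Lemma kern_weights Lam m r f x : Lam <> 0 ->
  kern Lam m r f x =
  (1 - lsum (sites m) (r x) / Lam) * f x
  + lsum (sites m) (fun j => r x j / Lam * f (incr x j)).
Proof.
  intros HL. unfold kern, gen.
  rewrite (lsum_ext _ (fun j => r x j / Lam * f (incr x j))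
             (fun j => / Lam * (r x j * f (incr x j)))) by (intros; field; easy).
  rewrite (lsum_ext _ (fun j => r x j * (f (incr x j) - f x))
             (fun j => r x j * f (incr x j) + - f x * r x j)) by (intros; ring).
  rewrite lsum_plus, !lsum_scal. field; easy.
Qed.

Lemma kern_le Lam m r f g x : uniformizable Lam m r ->
  f x <= g x -> (forall j, (1 <= j <= m)%nat -> f (incr x j) <= g (incr x j)) ->
  kern Lam m r f x <= kern Lam m r g x.
Proof.
  intros (HL & Hr & Ht) H0 H. rewrite !kern_weights by lra.
  apply Rplus_le_compat.
  - apply Rmult_le_compat_l; [|easy]. specialize (Ht x).
    apply (Rmult_le_compat_r (/ Lam)) in Ht; [|left; now apply Rinv_0_lt_compat].
    rewrite Rinv_r in Ht by lra. unfold Rdiv; lra.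
  - apply lsum_le. intros j Hj. apply Rmult_le_compat_l.
    + apply Rle_mult_inv_pos; auto.
    + apply H. now apply in_sites.
Qed.

Lemma gen_plus m r f g x :
  gen m r (fun y => f y + g y) x = gen m r f x + gen m r g x.
Proof. unfold gen. rewrite <- lsum_plus. apply lsum_ext; intros; ring. Qed.

Lemma gen_scal m r c f x : gen m r (fun y => c * f y) x = c * gen m r f x.
Proof. unfold gen. rewrite <- lsum_scal. apply lsum_ext; intros; ring. Qed.

Lemma gen_const m r c x : gen m r (fun _ => c) x = 0.
Proof.
  unfold gen. rewrite (lsum_ext _ _ (fun _ => 0)) by (intros; ring).
  rewrite lsum_const; ring.
Qed.

Lemma iterk_S Lam m r N f x :
  iterk Lam m r (S N) f x = kern Lam m r (iterk Lam m r N f) x.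
Proof. easy. Qed.

Lemma iterk_S' Lam m r N f : iterk Lam m r (S N) f = iterk Lam m r N (kern Lam m r f).
Proof. unfold iterk. now rewrite Nat.iter_succ_r. Qed.

Lemma iterk_add Lam m r N N' f :
  iterk Lam m r (N + N') f = iterk Lam m r N (iterk Lam m r N' f).
Proof. unfold iterk. now rewrite Nat.iter_add. Qed.

(** One shape for linearity and preservation of constants together; later uses fill the missing
    parts with [0 * 0] or [fun _ => 0]. *)
Lemma iterk_affine Lam m r N a f g b :
  iterk Lam m r N (fun x => a * f x + g x + b) =
  (fun x => a * iterk Lam m r N f x + iterk Lam m r N g x + b).
Proof.
  induction N as [|N IH]; [easy|].
  apply functional_extensionality; intros x. rewrite !iterk_S, IH. unfold kern.
  rewrite !(gen_plus m r), gen_scal, gen_const. unfold Rdiv. ring.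
Qed.

Lemma iterk_const Lam m r N c x : iterk Lam m r N (fun _ => c) x = c.
Proof.
  revert x; induction N as [|N IH]; intros x; [easy|].
  rewrite iterk_S. replace (iterk Lam m r N (fun _ => c)) with (fun _ : config => c)
    by (apply functional_extensionality; easy).
  unfold kern. rewrite gen_const. unfold Rdiv; ring.
Qed.

(** A crude superset of what [T] jumps can produce, enough to make the hypotheses of drift estimates
    local. *)
Definition reach (T : nat) (x y : config) : Prop := forall i, (x i <= y i <= x i + T)%nat.

Lemma reach_refl T x : reach T x x.
Proof. intros i; lia. Qed.

Lemma reach_incr T x j y : reach T (incr x j) y -> reach (S T) x y.
Proof. intros H i. specialize (H i). pose proof (incr_bounds x j i). lia. Qed.

Lemma reach_S T x y : reach T x y -> reach (S T) x y.
Proof. intros H i. specialize (H i). lia. Qed.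

Lemma iterk_le Lam m r N f g x : uniformizable Lam m r ->
  (forall y, reach N x y -> f y <= g y) -> iterk Lam m r N f x <= iterk Lam m r N g x.
Proof.
  intros HU. revert x; induction N as [|N IH]; intros x H.
  - apply H, reach_refl.
  - rewrite !iterk_S. apply kern_le; auto.
    + apply IH. intros y Hy. now apply H, reach_S.
    + intros j _. apply IH. intros y Hy. now apply H, (reach_incr _ _ j).
Qed.

Lemma iterk_drift Lam m r N f c x : uniformizable Lam m r ->
  (forall y, reach N x y -> gen m r f y <= c) ->
  iterk Lam m r N f x <= f x + INR N * (c / Lam).
Proof.
  intros HU. revert x; induction N as [|N IH]; intros x H.
  - simpl; lra.
  - rewrite iterk_S', S_INR.
    apply Rle_trans with (iterk Lam m r N (fun y => 0 * f y + f y + c / Lam) x).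
    + apply iterk_le; [easy|]. intros y Hy. unfold kern.
      assert (gen m r f y / Lam <= c / Lam).
      { apply Rmult_le_compat_r.
        - left; apply Rinv_0_lt_compat, HU.
        - now apply H, reach_S. }
      lra.
    + rewrite iterk_affine.
      assert (Hx : iterk Lam m r N f x <= f x + INR N * (c / Lam)).
      { apply IH. intros y Hy. now apply H, reach_S. }
      lra.
Qed.

(* Since [ln u <= u - 1], the drift of [ln S] is at most the relative drift of [S]. *)
Lemma gen_ln m r S x : (forall j, 0 <= r x j) -> (forall y, 0 < S y) ->
  gen m r (fun y => ln (S y)) x <= gen m r S x / S x.
Proof.
  intros Hr HS. unfold gen, Rdiv. rewrite Rmult_comm, <- lsum_scal.
  apply lsum_le. intros j _.
  pose proof (HS x) as H1; pose proof (HS (incr x j)) as H2.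
  rewrite <- Rmult_assoc, (Rmult_comm (/ S x)), Rmult_assoc.
  apply Rmult_le_compat_l; [easy|].
  assert (Hd : ln (S (incr x j) / S x) = ln (S (incr x j)) - ln (S x)).
  { unfold Rdiv. rewrite ln_mult, ln_Rinv by (try apply Rinv_0_lt_compat; easy). lra. }
  rewrite <- Hd.
  assert (Hq : 0 < S (incr x j) / S x) by (apply Rdiv_lt_0_compat; easy).
  pose proof (exp_ineq1_le (ln (S (incr x j) / S x))) as H.
  rewrite exp_ln in H by easy.
  replace (/ S x * (S (incr x j) - S x)) with (S (incr x j) / S x - 1) by (field; lra).
  lra.
Qed.

(** * Functions comparable to the maximum and the minimum *)

Fixpoint mx (m : nat) (x : config) : nat :=
  match m with 0%nat => 0%nat | S m' => Nat.max (mx m' x) (x m) end.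

Fixpoint mn (m : nat) (x : config) : nat :=
  match m with
  | 0%nat => 0%nat
  | 1%nat => x 1%nat
  | S m' => Nat.min (mn m' x) (x m)
  end.

Lemma mx_ub m x i : (1 <= i <= m)%nat -> (x i <= mx m x)%nat.
Proof.
  induction m as [|m IH]; [lia|]. simpl. intros Hi.
  destruct (Nat.eq_dec i (S m)) as [->|]; lia.
Qed.

Lemma mx_attained m x : (1 <= m)%nat -> exists i, (1 <= i <= m)%nat /\ x i = mx m x.
Proof.
  induction m as [|[|m] IH]; [lia| |]; intros _.
  - exists 1%nat. simpl. lia.
  - destruct IH as (i & Hi & Hx); [lia|].
    change (mx (S (S m)) x) with (Nat.max (mx (S m) x) (x (S (S m)))).
    destruct (Nat.max_spec (mx (S m) x) (x (S (S m)))) as [[_ ->]|[_ ->]].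
    + exists (S (S m)); lia.
    + exists i; lia.
Qed.

Lemma mn_lb m x i : (1 <= i <= m)%nat -> (mn m x <= x i)%nat.
Proof.
  induction m as [|[|m] IH]; [lia| |].
  - intros Hi. replace i with 1%nat by lia. simpl; lia.
  - intros Hi. change (mn (S (S m)) x) with (Nat.min (mn (S m) x) (x (S (S m)))).
    destruct (Nat.eq_dec i (S (S m))) as [->|]; lia.
Qed.

Lemma mn_attained m x : (1 <= m)%nat -> exists i, (1 <= i <= m)%nat /\ x i = mn m x.
Proof.
  induction m as [|[|m] IH]; [lia| |]; intros _.
  - exists 1%nat. simpl. lia.
  - destruct IH as (i & Hi & Hx); [lia|].
    change (mn (S (S m)) x) with (Nat.min (mn (S m) x) (x (S (S m)))).
    destruct (Nat.min_spec (mn (S m) x) (x (S (S m)))) as [[_ ->]|[_ ->]].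
    + exists i; lia.
    + exists (S (S m)); lia.
Qed.

Lemma mn_le_mx m x : (1 <= m)%nat -> (mn m x <= mx m x)%nat.
Proof.
  intros Hm. destruct (mx_attained m x Hm) as (i & Hi & <-). now apply mn_lb.
Qed.

Lemma mx_lub m x M : (forall i, (1 <= i <= m)%nat -> (x i <= M)%nat) -> (mx m x <= M)%nat.
Proof.
  induction m as [|m IH]; simpl; intros H; [lia|].
  apply Nat.max_lub; [apply IH; intros; apply H; lia | apply H; lia].
Qed.

Lemma mx_reach m T x y : reach T x y -> (mx m x <= mx m y <= mx m x + T)%nat.
Proof.
  intros H; split; apply mx_lub; intros i Hi; specialize (H i).
  - pose proof (mx_ub m y i Hi); lia.
  - pose proof (mx_ub m x i Hi); lia.
Qed.

Lemma mn_reach m T x y : (1 <= m)%nat ->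
  reach T x y -> (mn m x <= mn m y <= mn m x + T)%nat.
Proof.
  intros Hm H; split.
  - destruct (mn_attained m y Hm) as (i & Hi & <-). specialize (H i).
    pose proof (mn_lb m x i Hi); lia.
  - destruct (mn_attained m x Hm) as (i & Hi & <-). specialize (H i).
    pose proof (mn_lb m y i Hi); lia.
Qed.

Definition rng (m : nat) (x : config) : R := INR (mx m x) - INR (mn m x).

Lemma rng_nonneg m x : (1 <= m)%nat -> 0 <= rng m x.
Proof. intros Hm. pose proof (le_INR _ _ (mn_le_mx m x Hm)). unfold rng; lra. Qed.

Lemma rng_reach m T x y : (1 <= m)%nat -> reach T x y ->
  rng m x - INR T <= rng m y <= rng m x + INR T.
Proof.
  intros Hm H. unfold rng.
  destruct (mx_reach m T x y H) as [H1 H2].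
  destruct (mn_reach m T x y Hm H) as [H3 H4].
  apply le_INR in H1, H2, H3, H4. rewrite plus_INR in H2, H4. lra.
Qed.

(** The range itself has no uniformly negative one-step drift. Replacing it by [up + low] costs
    [Cu + Cl] once, while the gain grows linearly in [T]. *)
Lemma rng_drift Lam m r x T up low cu cl Cu Cl :
  uniformizable Lam m r ->
  (forall y, reach T x y ->
     INR (mx m y) <= up y /\ - INR (mn m y) <= low y /\
     gen m r up y <= cu /\ gen m r low y <= - cl) ->
  up x <= INR (mx m x) + Cu -> low x <= - INR (mn m x) + Cl ->
  iterk Lam m r T (rng m) x <= rng m x + (Cu + Cl) - INR T * ((cl - cu) / Lam).
Proof.
  intros HU H Hu Hl.
  apply Rle_trans with (iterk Lam m r T (fun y => up y + low y) x).
  - apply iterk_le; [easy|]. intros y Hy. specialize (H y Hy). unfold rng. lra.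
  - eapply Rle_trans.
    + apply (iterk_drift _ _ _ _ _ (cu - cl)); [easy|].
      intros y Hy. specialize (H y Hy). rewrite gen_plus. lra.
    + unfold rng, Rdiv. lra.
Qed.

Lemma exp_le_quadratic u : 0 <= u <= 1 / 2 -> exp u <= 1 + u + 2 * u * u.
Proof.
  intros Hu. pose proof (exp_ineq1_le (- u)) as H. rewrite exp_Ropp in H.
  pose proof (exp_pos u) as Hp.
  assert (H1 : exp u * (1 - u) <= 1).
  { apply (Rmult_le_compat_l (exp u)) in H; [|lra].
    rewrite Rinv_r in H by lra. lra. }
  nra.
Qed.

Lemma exp_neg_le_quadratic s : 0 <= s -> s * (1 - s) <= 1 - exp (- s).
Proof.
  intros Hs. rewrite exp_Ropp. pose proof (exp_ineq1_le s) as H.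
  assert (H1 : / exp s <= / (1 + s)) by (apply Rinv_le_contravar; lra).
  assert (H2 : / (1 + s) <= 1 - s + s * s).
  { apply (Rmult_le_reg_l (1 + s)); [lra|]. rewrite Rinv_r by lra.
    assert (0 <= s * s * s) by (repeat apply Rmult_le_pos; lra). nra. }
  nra.
Qed.

Definition wsum (w : nat -> R) (s : R) (m : nat) (x : config) : R :=
  lsum (sites m) (fun i => w i * exp (s * INR (x i))).

Lemma gen_wsum w s m r x :
  gen m r (wsum w s m) x =
  (exp s - 1) * lsum (sites m) (fun i => r x i * (w i * exp (s * INR (x i)))).
Proof.
  unfold gen. rewrite <- lsum_scal. apply lsum_ext. intros j Hj. unfold wsum.
  rewrite (lsum_update (sites m) (fun i => w i * exp (s * INR (x i)))
             (fun i => w i * exp (s * INR (incr x j i))) j).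
  - rewrite incr_same, S_INR, Rmult_plus_distr_l, exp_plus, Rmult_1_r. ring.
  - apply seq_NoDup.
  - easy.
  - intros i Hi. now rewrite incr_other.
Qed.

Lemma wsum_pos w s m x : (1 <= m)%nat -> (forall i, 0 < w i) -> 0 < wsum w s m x.
Proof.
  intros Hm Hw. apply Rlt_le_trans with (w 1%nat * exp (s * INR (x 1%nat))).
  - apply Rmult_lt_0_compat; [easy|apply exp_pos].
  - apply (lsum_ge_term (sites m) (fun i => w i * exp (s * INR (x i)))).
    + intros i _. apply Rmult_le_pos; [now left|left; apply exp_pos].
    + apply in_sites; lia.
Qed.

Lemma ln_le x y : 0 < x -> x <= y -> ln x <= ln y.
Proof. intros Hx [H| ->]; [left; now apply ln_increasing|lra]. Qed.

Lemma exp_le x y : x <= y -> exp x <= exp y.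
Proof. intros [H| ->]; [left; now apply exp_increasing|lra]. Qed.

(** Isolates what the upper estimate uses of the rates, so that it serves both the attractive
    process and the crystal. *)
Definition capped (m : nat) (b0 b1 : R) (r : config -> nat -> R) (y : config) : Prop :=
  (forall i, (1 <= i <= m)%nat -> r y i <= b1) /\
  (forall i, (1 <= i <= m)%nat -> y i = mx m y -> r y i <= b0).

(* For small [s], the growth rate of [ln (sum_i exp (s x_i)) / s] is about the
   [exp (s x_i)]-weighted average of the rates. A highest site, whose rate is only [b0],
   carries at least the fraction [1/m] of the weight. *)
Lemma upper_function (m : nat) (b0 b1 : R) :
  (1 <= m)%nat -> 0 < b0 < b1 ->
  exists eta C up, 0 < eta /\
    (forall y, INR (mx m y) <= up y <= INR (mx m y) + C) /\
    (forall r y, (forall j, 0 <= r y j) -> capped m b0 b1 r y ->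
       gen m r up y <= b1 - eta).
Proof.
  intros Hm Hb.
  assert (Hm' : 1 <= INR m) by (change 1 with (INR 1); now apply le_INR).
  set (h := (b1 - b0) / INR m).
  assert (Hh : 0 < h) by (apply Rdiv_lt_0_compat; lra).
  assert (Hh' : h <= b1 - b0).
  { unfold h. apply (Rmult_le_reg_r (INR m)); [lra|].
    unfold Rdiv. rewrite Rmult_assoc, Rinv_l by lra. nra. }
  (* The second-order term of [exp s - 1] adds at most [2 * s * b1 = h / 2] to the speed [b1 - h];
     the other half of [h] remains as [eta]. *)
  set (s := h / (4 * b1)).
  assert (Hs : 0 < s) by (apply Rdiv_lt_0_compat; lra).
  assert (Hsb : s * b1 = h / 4) by (unfold s; field; lra).
  assert (Hs' : s <= 1 / 2) by nra.
  set (S := wsum (fun _ => 1) s m).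
  assert (HS : forall y, 0 < S y) by (intros; apply wsum_pos; [easy|intros; lra]).
  exists (h / 2), (ln (INR m) / s), (fun y => / s * ln (S y)).
  split; [lra|]. split.
  - intros y. destruct (mx_attained m y Hm) as (p & Hp & Hpx). split.
    + apply (Rmult_le_reg_l s); [easy|]. rewrite <- Rmult_assoc, Rinv_r, Rmult_1_l by lra.
      rewrite <- (ln_exp (s * INR (mx m y))). apply ln_le; [apply exp_pos|].
      rewrite <- Hpx, <- (Rmult_1_l (exp _)).
      apply (lsum_ge_term (sites m) (fun i => 1 * exp (s * INR (y i)))).
      * intros i _. rewrite Rmult_1_l. left; apply exp_pos.
      * now apply in_sites.
    + apply (Rmult_le_reg_l s); [easy|].
      replace (s * (INR (mx m y) + ln (INR m) / s)) with (ln (INR m) + s * INR (mx m y))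
        by (field; lra).
      rewrite <- Rmult_assoc, Rinv_r, Rmult_1_l by lra.
      rewrite <- (ln_exp (s * INR (mx m y))), <- ln_mult by (apply exp_pos || lra).
      apply ln_le; [easy|]. unfold S, wsum.
      eapply Rle_trans; [apply lsum_le_const|rewrite length_sites; apply Rle_refl].
      intros i Hi. rewrite Rmult_1_l. apply in_sites in Hi.
      apply exp_le. apply Rmult_le_compat_l; [lra|]. apply le_INR. now apply mx_ub.
  - intros r y Hr [Hcap Htop]. rewrite gen_scal.
    destruct (mx_attained m y Hm) as (p & Hp & Hpx).
    pose proof (gen_ln m r S y (Hr) HS) as Hg.
    set (e := fun i => exp (s * INR (y i))).
    assert (He : forall i, 0 < e i) by (intros; apply exp_pos).
    assert (HSe : S y = lsum (sites m) e) by (apply lsum_ext; intros; unfold e; ring).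
    assert (Hpm : S y <= INR m * e p).
    { rewrite HSe. eapply Rle_trans; [apply lsum_le_const|rewrite length_sites; apply Rle_refl].
      intros i Hi. apply in_sites in Hi. apply exp_le. apply Rmult_le_compat_l; [lra|].
      rewrite Hpx. apply le_INR. now apply mx_ub. }
    assert (Hrate : lsum (sites m) (fun i => r y i * (1 * exp (s * INR (y i)))) <= (b1 - h) * S y).
    { apply Rle_trans with (b1 * S y - (b1 - b0) * e p).
      - set (g := fun i => b1 * e i - r y i * (1 * exp (s * INR (y i)))).
        assert (Hgp : g p <= lsum (sites m) g).
        { apply lsum_ge_term; [|now apply in_sites]. intros i Hi. apply in_sites in Hi.
          unfold g. fold (e i). specialize (He i). specialize (Hcap i Hi). nra. }
        replace (lsum (sites m) g) with
          (b1 * S y - lsum (sites m) (fun i => r y i * (1 * exp (s * INR (y i))))) in Hgp.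
        2:{ unfold g. rewrite HSe, <- lsum_scal.
            rewrite (lsum_ext (sites m) (fun i => b1 * e i - r y i * (1 * exp (s * INR (y i))))
              (fun i => b1 * e i + (-1) * (r y i * (1 * exp (s * INR (y i))))))
              by (intros; ring).
            rewrite lsum_plus, (lsum_scal _ (-1)). ring. }
        assert ((b1 - b0) * e p <= g p).
        { unfold g. fold (e p). specialize (He p). specialize (Htop p Hp Hpx). nra. }
        lra.
      - assert (h * S y <= (b1 - b0) * e p).
        { apply Rle_trans with (h * (INR m * e p)).
          - apply Rmult_le_compat_l; lra.
          - unfold h. right. field. lra. }
        lra. }
    assert (Hgs : gen m r S y / S y <= (exp s - 1) * (b1 - h)).
    { unfold S at 1. rewrite gen_wsum.
      apply (Rmult_le_reg_r (S y)); [easy|].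
      unfold Rdiv. rewrite Rmult_assoc, Rinv_l, Rmult_1_r by (specialize (HS y); lra).
      rewrite Rmult_assoc. apply Rmult_le_compat_l; [|easy].
      pose proof (exp_ineq1_le s); lra. }
    pose proof (exp_le_quadratic s) as Hq.
    apply (Rmult_le_reg_l s); [easy|]. rewrite <- Rmult_assoc, Rinv_r, Rmult_1_l by lra.
    assert ((exp s - 1) * (b1 - h) <= (s + 2 * s * s) * (b1 - h))
      by (apply Rmult_le_compat_r; lra).
    nra.
Qed.

Definition pushed (m : nat) (b : R) (r : config -> nat -> R) (y : config) : Prop :=
  forall i j, (1 <= i <= m)%nat -> (1 <= j <= m)%nat -> (j = S i \/ i = S j) ->
    (y i < y j)%nat -> b <= r y i.

(* The weights decrease geometrically away from [p]. A site not below its neighbour on the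
   side of [p], whose rate is uncontrolled, is then negligible against that neighbour in
   the sum; the site [p] itself is negligible when it is high. *)
Lemma lower_function (m : nat) (b eps : R) :
  (1 <= m)%nat -> 0 < b -> 0 < eps ->
  exists (D : nat) (C : R) (low : nat -> config -> R),
    (forall p y, (1 <= p <= m)%nat -> - INR (mn m y) <= low p y <= - INR (mn m y) + C) /\
    (forall r p y, (1 <= p <= m)%nat -> (forall j, 0 <= r y j) -> pushed m b r y ->
       (mn m y + D <= y p)%nat -> gen m r (low p) y <= - (b - eps)).
Proof.
  intros Hm Hb Heps.
  assert (Hm' : 1 <= INR m) by (change 1 with (INR 1); now apply le_INR).
  set (s := Rmin 1 (eps / (2 * b))).
  assert (Hs : 0 < s) by (apply Rmin_pos; [lra|apply Rdiv_lt_0_compat; lra]).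
  assert (Hs1 : s <= 1) by apply Rmin_l.
  assert (Hs2 : s * b <= eps / 2).
  { apply Rle_trans with (eps / (2 * b) * b).
    - apply Rmult_le_compat_r; [lra|apply Rmin_r].
    - right; field; lra. }
  (* [eps] is spent in halves: [s * b <= eps / 2] pays for the expansion of [exp (- s)], and [A]
     makes the loss [b / A] at each of the [m] sites add up to at most [eps / 2]. *)
  set (A := 1 + 2 * INR m * b / eps).
  assert (HA : 1 <= A).
  { assert (0 < 2 * INR m * b / eps) by (apply Rdiv_lt_0_compat; nra). unfold A; lra. }
  assert (HmA : INR m * b / A <= eps / 2).
  { apply (Rmult_le_reg_r A); [lra|].
    unfold Rdiv at 1. rewrite Rmult_assoc, Rinv_l by lra.
    replace (eps / 2 * A) with (eps / 2 + INR m * b) by (unfold A; field; lra). lra. }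
  assert (HAk : forall i, 1 <= A ^ i) by (intros; now apply pow_R1_Rle).
  (* The site [p] has weight at most [A ^ m]; a height [D] above the minimum beats this weight and
     one further factor [A]. *)
  destruct (INR_unbounded (A ^ (m + 1) / s)) as (D & HD).
  assert (HD' : A ^ (m + 1) <= exp (s * INR D)).
  { assert (A ^ (m + 1) < s * INR D).
    { apply (Rmult_lt_compat_l s) in HD; [|easy].
      replace (s * (A ^ (m + 1) / s)) with (A ^ (m + 1)) in HD by (field; lra). easy. }
    pose proof (exp_ineq1_le (s * INR D)). lra. }
  set (dist p i := ((p - i) + (i - p))%nat).
  set (w p i := A ^ (m - dist p i)).
  set (U p := wsum (w p) (- s) m).
  assert (Hw : forall p i, 1 <= w p i) by (intros; apply HAk).
  assert (Hw' : forall p i, w p i <= A ^ m) by (intros; apply Rle_pow; [lra|lia]).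
  assert (HU : forall p y, 0 < U p y).
  { intros. apply wsum_pos; [easy|]. intros i; specialize (Hw p i); lra. }
  assert (Hterm : forall p y i, (1 <= i <= m)%nat -> w p i * exp (- s * INR (y i)) <= U p y).
  { intros p y i Hi. apply (lsum_ge_term (sites m) (fun i => w p i * exp (- s * INR (y i)))).
    - intros j _. specialize (Hw p j). apply Rmult_le_pos; [lra|left; apply exp_pos].
    - now apply in_sites. }
  assert (Hmin : forall p y, exp (- s * INR (mn m y)) <= U p y).
  { intros p y. destruct (mn_attained m y Hm) as (i & Hi & <-).
    eapply Rle_trans; [|apply (Hterm p y i Hi)].
    rewrite <- (Rmult_1_l (exp _)) at 1. apply Rmult_le_compat_r; [left; apply exp_pos|easy]. }
  exists D, (/ s * ln (INR m * A ^ m)), (fun p y => / s * ln (U p y)). split.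
  - intros p y Hp. split.
    + apply (Rmult_le_reg_l s); [easy|]. rewrite <- Rmult_assoc, Rinv_r, Rmult_1_l by lra.
      replace (s * - INR (mn m y)) with (- s * INR (mn m y)) by ring.
      rewrite <- (ln_exp (- s * INR (mn m y))). apply ln_le; [apply exp_pos|easy].
    + apply (Rmult_le_reg_l s); [easy|].
      rewrite Rmult_plus_distr_l, <- !Rmult_assoc, Rinv_r, !Rmult_1_l by lra.
      replace (s * - INR (mn m y)) with (- s * INR (mn m y)) by ring.
      specialize (HAk m).
      rewrite <- (ln_exp (- s * INR (mn m y))), Rplus_comm, <- ln_mult
        by (apply exp_pos || nra).
      apply ln_le; [easy|]. unfold U, wsum. rewrite Rmult_assoc.
      eapply Rle_trans; [apply lsum_le_const|rewrite length_sites; apply Rle_refl].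
      intros i Hi. apply in_sites in Hi. apply Rmult_le_compat.
      * specialize (Hw p i); lra.
      * left; apply exp_pos.
      * apply Hw'.
      * apply exp_le. pose proof (le_INR _ _ (mn_lb m y i Hi)). nra.
  - intros r p y Hp Hr Hpush HpD. rewrite gen_scal.
    pose proof (gen_ln m r (U p) y Hr (HU p)) as Hg.
    set (a := fun i => w p i * exp (- s * INR (y i))).
    assert (Ha : forall i, 0 < a i).
    { intros i. specialize (Hw p i). apply Rmult_lt_0_compat; [lra|apply exp_pos]. }
    assert (Hsmall : forall i, (1 <= i <= m)%nat -> b * a i - r y i * a i <= b / A * U p y).
    { intros i Hi.
      assert (HbA : 0 < b / A) by (apply Rdiv_lt_0_compat; lra).
      specialize (Hr i). specialize (Ha i) as Hai. specialize (HU p y) as HUy.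
      (* A site whose term is at most [U / A] may even have rate zero: the loss stays within
         [b / A * U]. *)
      assert (Hneg : a i * A <= U p y -> b * a i - r y i * a i <= b / A * U p y).
      { intros H. apply Rle_trans with (b / A * (a i * A)).
        - replace (b / A * (a i * A)) with (b * a i) by (field; lra). nra.
        - apply Rmult_le_compat_l; lra. }
      destruct (Nat.eq_dec i p) as [->|Hip].
      - apply Hneg. eapply Rle_trans; [|apply Hmin].
        apply Rle_trans with (A ^ (m + 1) * exp (- s * INR (y p))).
        + replace (m + 1)%nat with (S m) by lia. simpl pow. unfold a.
          specialize (Hw' p p). pose proof (exp_pos (- s * INR (y p))).
          replace (A * A ^ m * exp (- s * INR (y p))) with (A ^ m * exp (- s * INR (y p)) * A)
            by ring.
          apply Rmult_le_compat_r; [lra|]. apply Rmult_le_compat_r; lra.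
        + apply Rle_trans with (exp (s * INR D) * exp (- s * INR (y p))).
          * apply Rmult_le_compat_r; [left; apply exp_pos|easy].
          * rewrite <- exp_plus. apply exp_le. apply le_INR in HpD.
            rewrite plus_INR in HpD. nra.
      (* [i'] is the neighbour of [i] one step closer to [p]. Either it is higher and pushes [i], or
         its term is at least [A] times that of [i]. *)
      - set (i' := if Nat.ltb i p then S i else (i - 1)%nat).
        assert (Hi' : (1 <= i' <= m)%nat /\ (i' = S i \/ i = S i')
                      /\ (m - dist p i' = S (m - dist p i))%nat).
        { unfold i', dist. destruct (Nat.ltb_spec i p); lia. }
        destruct Hi' as (Hi'1 & Hi'2 & Hi'3).
        destruct (Nat.lt_ge_cases (y i) (y i')) as [Hlt|Hge].
        + specialize (Hpush i i' Hi Hi'1 Hi'2 Hlt). nra.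
        + apply Hneg. eapply Rle_trans; [|apply (Hterm p y i' Hi'1)].
          unfold a, w. rewrite Hi'3. simpl pow.
          replace (A ^ (m - dist p i) * exp (- s * INR (y i)) * A)
            with (A * A ^ (m - dist p i) * exp (- s * INR (y i))) by ring.
          apply Rmult_le_compat_l; [specialize (HAk (m - dist p i)%nat); nra|].
          apply exp_le. apply le_INR in Hge. nra. }
    assert (Hrate : (b - eps / 2) * U p y <= lsum (sites m) (fun i => r y i * a i)).
    { assert (H : lsum (sites m) (fun i => b * a i - r y i * a i) <= INR m * (b / A * U p y)).
      { rewrite <- (length_sites m) at 2. apply lsum_le_const.
        intros i Hi. apply Hsmall. now apply in_sites. }
      rewrite (lsum_ext _ _ (fun i => b * a i + (-1) * (r y i * a i))) in H by (intros; ring).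
      rewrite lsum_plus, !lsum_scal in H.
      change (lsum (sites m) a) with (U p y) in H.
      specialize (HU p y).
      assert (INR m * (b / A * U p y) <= eps / 2 * U p y).
      { replace (INR m * (b / A * U p y)) with (INR m * b / A * U p y) by (unfold Rdiv; ring).
        apply Rmult_le_compat_r; lra. }
      lra. }
    assert (Hgs : gen m r (U p) y / U p y <= (exp (- s) - 1) * (b - eps / 2)).
    { unfold U at 1. rewrite gen_wsum. fold (U p). specialize (HU p y).
      apply (Rmult_le_reg_r (U p y)); [easy|].
      unfold Rdiv. rewrite Rmult_assoc, Rinv_l, Rmult_1_r by lra.
      assert (exp (- s) <= 1) by (rewrite <- exp_0; apply exp_le; lra).
      fold (eps / 2). unfold a in Hrate.
      pose proof (Rmult_le_compat_l (1 - exp (- s)) _ _ ltac:(lra) Hrate). lra. }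
    pose proof (exp_neg_le_quadratic s ltac:(lra)) as Hq.
    apply (Rmult_le_reg_l s); [easy|]. rewrite <- Rmult_assoc, Rinv_r, Rmult_1_l by lra.
    eapply Rle_trans; [apply Hg|]. eapply Rle_trans; [apply Hgs|].
    assert (exp (- s) <= 1) by (rewrite <- exp_0; apply exp_le; lra).
    assert (1 - exp (-s) <= s) by (pose proof (exp_ineq1_le (- s)); lra).
    assert (s * (1 - s) * b <= (1 - exp (- s)) * b) by (apply Rmult_le_compat_r; lra).
    nra.
Qed.

(** * The attractive process with parameter (b0, b1, b1) *)

Lemma xb_in m x i : (1 <= i <= m)%nat -> xb m x i = x i.
Proof.
  intros [H1 H2]. unfold xb. apply Nat.leb_le in H1, H2. now rewrite H1, H2.
Qed.

Lemma xb_out m x i : ~ (1 <= i <= m)%nat -> xb m x i = 0%nat.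
Proof.
  intros H. unfold xb. destruct (Nat.leb_spec 1 i), (Nat.leb_spec i m); simpl; lia.
Qed.

Lemma rate_bounds b0 b1 b2 m x j : 0 < b0 -> b0 <= b2 -> b2 <= b1 ->
  b0 <= rate b0 b1 b2 m x j <= b1.
Proof. intros. unfold rate, beta_of. destruct (V m x j) as [|[|]]; lra. Qed.

Lemma rate_top b0 b1 b2 m x j :
  (xb m x (j - 1) <= xb m x j)%nat -> (xb m x (j + 1) <= xb m x j)%nat ->
  rate b0 b1 b2 m x j = b0.
Proof.
  intros H1 H2. unfold rate, V.
  now apply Nat.ltb_ge in H1 as ->; apply Nat.ltb_ge in H2 as ->.
Qed.

Lemma rate_pushed b0 b1 b2 m x j : b2 <= b1 ->
  (xb m x j < xb m x (j - 1) \/ xb m x j < xb m x (j + 1))%nat ->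
  b2 <= rate b0 b1 b2 m x j.
Proof.
  intros Hb H. unfold rate, V.
  destruct H as [H|H]; apply Nat.ltb_lt in H as ->;
    destruct (Nat.ltb _ _); simpl; lra.
Qed.

Lemma uniformizable_rate b0 b1 b2 m : (1 <= m)%nat -> 0 < b0 -> b0 <= b2 -> b2 <= b1 ->
  uniformizable (unif b0 b1 b2 m) m (rate b0 b1 b2 m).
Proof.
  intros Hm H0 H02 H21.
  assert (Hm' : 1 <= INR m) by (change 1 with (INR 1); now apply le_INR).
  unfold unif. split; [nra|split].
  - intros x j. pose proof (rate_bounds b0 b1 b2 m x j H0 H02 H21). lra.
  - intros x. rewrite <- (length_sites m) at 3. apply lsum_le_const.
    intros j _. pose proof (rate_bounds b0 b1 b2 m x j H0 H02 H21). lra.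
Qed.

Lemma capped_rate b0 b1 b2 m y : 0 < b0 -> b0 <= b2 -> b2 <= b1 ->
  capped m b0 b1 (rate b0 b1 b2 m) y.
Proof.
  intros H0 H02 H21. split; intros i Hi.
  - now apply rate_bounds.
  - intros Htop. right. apply rate_top; rewrite (xb_in m y i Hi).
    + destruct (Nat.eq_dec i 1) as [->|]; [rewrite xb_out; lia|].
      rewrite xb_in, Htop by lia. apply mx_ub; lia.
    + destruct (Nat.eq_dec i m) as [->|]; [rewrite xb_out; lia|].
      rewrite xb_in, Htop by lia. apply mx_ub; lia.
Qed.

Lemma pushed_rate b0 b1 b2 m y : b2 <= b1 -> pushed m b2 (rate b0 b1 b2 m) y.
Proof.
  intros Hb i j Hi Hj Hij Hlt. apply rate_pushed; [easy|].
  rewrite (xb_in m y i Hi). destruct Hij as [->|Hij].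
  - right. rewrite Nat.add_1_r, xb_in; easy.
  - left. replace (i - 1)%nat with j by lia. rewrite xb_in; easy.
Qed.

(** When [b2 = b1] the low sites are pushed at the largest rate: they lose at most [eta / 2] against
    [b1], while the maximum loses [eta]. *)
Lemma tilde_rng_drift b0 b1 m : (1 <= m)%nat -> 0 < b0 < b1 ->
  exists T L : nat, (1 <= T)%nat /\ forall x, INR L <= rng m x ->
    iterk (unif b0 b1 b1 m) m (rate b0 b1 b1 m) T (rng m) x <= rng m x - 1.
Proof.
  intros Hm Hb. set (Lam := unif b0 b1 b1 m). set (r := rate b0 b1 b1 m).
  assert (HU : uniformizable Lam m r) by (apply uniformizable_rate; lra || easy).
  assert (HL : 0 < Lam) by apply HU.
  destruct (upper_function m b0 b1 Hm Hb) as (eta & Cu & up & Heta & Hup & Hupd).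
  destruct (lower_function m b1 (eta / 2) Hm) as (D & Cl & low & Hlow & Hlowd); [lra..|].
  destruct (INR_unbounded ((Cu + Cl + 1) * Lam / (eta / 2))) as (T & HT).
  (* The minimum may rise by [S T] meanwhile; the extra [S T] keeps the initially highest site [D]
     above it. *)
  exists (S T), (D + S T)%nat. split; [lia|]. intros x Hx.
  destruct (mx_attained m x Hm) as (p & Hp & Hpx).
  eapply Rle_trans.
  - apply (rng_drift _ _ _ _ _ up (low p) (b1 - eta) (b1 - eta / 2) Cu Cl HU).
    + intros y Hy. repeat split.
      * apply Hup.
      * now apply Hlow.
      * apply Hupd; [apply HU|apply capped_rate; lra].
      * apply Hlowd; [easy|apply HU|apply pushed_rate; lra|].
        destruct (mn_reach m (S T) x y Hm Hy) as [_ Hmn].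
        unfold rng in Hx. rewrite <- Hpx in Hx.
        assert (INR (D + S T) + INR (mn m x) <= INR (x p)) as H by lra.
        rewrite <- plus_INR in H. apply INR_le in H. specialize (Hy p). lia.
    + apply Hup.
    + now apply Hlow.
  - assert (Cu + Cl + 1 <= INR (S T) * ((b1 - eta / 2 - (b1 - eta)) / Lam)); [|lra].
    replace (b1 - eta / 2 - (b1 - eta)) with (eta / 2) by lra.
    assert (Hpos : 0 < eta / 2 / Lam) by (apply Rdiv_lt_0_compat; lra).
    apply Rle_trans with ((Cu + Cl + 1) * Lam / (eta / 2) * (eta / 2 / Lam)).
    + right. field. lra.
    + apply Rmult_le_compat_r; [lra|]. rewrite S_INR. lra.
Qed.

(* A nonpositive drift of the range bounds the growth of its second moment. *)
Lemma tilde_rng_square b0 b1 m : (1 <= m)%nat -> 0 < b0 < b1 ->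
  exists (T : nat) (C : R), (1 <= T)%nat /\ 0 < C /\ forall j : nat,
    iterk (unif b0 b1 b1 m) m (rate b0 b1 b1 m) (j * T) (fun x => rng m x * rng m x)
      zero_config <= INR j * C.
Proof.
  intros Hm Hb. destruct (tilde_rng_drift b0 b1 m Hm Hb) as (T & L & HT & HD).
  set (Lam := unif b0 b1 b1 m) in *. set (r := rate b0 b1 b1 m) in *.
  assert (HU : uniformizable Lam m r) by (apply uniformizable_rate; lra || easy).
  assert (HT' : 1 <= INR T) by (change 1 with (INR 1); now apply le_INR).
  set (C := (INR L + INR T) * (INR L + INR T)).
  pose proof (pos_INR L) as HLp.
  assert (HC : 0 < C) by (unfold C; nra).
  exists T, C. split; [easy|]. split; [easy|].
  assert (Hstep : forall x, iterk Lam m r T (fun x => rng m x * rng m x) x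
                            <= rng m x * rng m x + C).
  { intros x. pose proof (rng_nonneg m x Hm) as Hx.
    destruct (Rle_lt_dec (INR L) (rng m x)) as [Hlarge|Hsmall].
    (* Expands the square of [rng y] around [rng x]: the linear term has nonpositive drift, and the
       squared increment is at most [INR T * INR T]. *)
    - apply Rle_trans with (iterk Lam m r T
        (fun y => 2 * rng m x * rng m y + (fun _ => - (rng m x * rng m x)) y
                  + INR T * INR T) x).
      + apply iterk_le; [easy|]. intros y Hy.
        pose proof (rng_reach m T x y Hm Hy). nra.
      + rewrite iterk_affine, iterk_const. specialize (HD x Hlarge).
        assert (2 * rng m x * iterk Lam m r T (rng m) x <= 2 * rng m x * rng m x).
        { apply Rmult_le_compat_l; lra. }
        unfold C. nra.
    - apply Rle_trans with (iterk Lam m r T (fun _ => C) x).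
      + apply iterk_le; [easy|]. intros y Hy.
        pose proof (rng_reach m T x y Hm Hy). pose proof (rng_nonneg m y Hm).
        unfold C. apply Rmult_le_compat; lra.
      + rewrite iterk_const. nra. }
  induction j as [|j IH].
  - simpl. unfold iterk. simpl. right.
    assert (rng m zero_config = 0) as ->; [|ring].
    unfold rng. destruct (mx_attained m zero_config Hm) as (i & _ & <-).
    destruct (mn_attained m zero_config Hm) as (i' & _ & <-). unfold zero_config; lra.
  - replace (S j * T)%nat with (j * T + T)%nat by lia. rewrite iterk_add, S_INR.
    apply Rle_trans with (iterk Lam m r (j * T)
      (fun y => 0 * 0 + rng m y * rng m y + C) zero_config).
    + apply iterk_le; [easy|]. intros y _. specialize (Hstep y). lra.
    + rewrite (iterk_affine _ _ _ _ 0 (fun _ => 0) (fun y => rng m y * rng m y)). lra.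
Qed.

(** * Translation invariance and attractiveness *)

Definition shift (c : nat) (x : config) : config := fun i => (x i + c)%nat.

(** The zero boundary is compatible with translations because only strict comparisons enter: a value
    0 outside the crystal is never above a site. *)
Lemma V_shift m c x j : (1 <= j <= m)%nat -> V m (shift c x) j = V m x j.
Proof.
  intros Hj.
  assert (H : forall i, Nat.ltb (xb m (shift c x) j) (xb m (shift c x) i)
                        = Nat.ltb (xb m x j) (xb m x i)).
  { intros i. rewrite !(xb_in m _ j Hj).
    destruct (Nat.eq_dec (xb m (shift c x) i) 0) as [E|E].
    - destruct (Nat.leb_spec 1 i), (Nat.leb_spec i m);
        try (rewrite !xb_out by lia; now destruct (Nat.ltb_spec (shift c x j) 0),
               (Nat.ltb_spec (x j) 0)).
      rewrite !xb_in in * by easy. unfold shift in *.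
      destruct (Nat.ltb_spec (x j + c) (x i + c)), (Nat.ltb_spec (x j) (x i)); lia || easy.
    - assert (Hi : (1 <= i <= m)%nat).
      { destruct (Nat.leb_spec 1 i), (Nat.leb_spec i m); try easy;
          rewrite xb_out in E; lia. }
      rewrite !xb_in by easy. unfold shift.
      destruct (Nat.ltb_spec (x j + c) (x i + c)), (Nat.ltb_spec (x j) (x i)); lia || easy. }
  unfold V. now rewrite !H.
Qed.

Lemma incr_shift c x j : incr (shift c x) j = shift c (incr x j).
Proof.
  apply functional_extensionality; intros i. unfold shift, incr.
  destruct (Nat.eqb i j); lia.
Qed.

Lemma iterk_shift Lam b0 b1 b2 m N c f x :
  iterk Lam m (rate b0 b1 b2 m) N f (shift c x) =
  iterk Lam m (rate b0 b1 b2 m) N (fun y => f (shift c y)) x.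
Proof.
  revert x; induction N as [|N IH]; intros x; [easy|].
  rewrite !iterk_S. unfold kern. rewrite IH. f_equal. f_equal.
  apply lsum_ext. intros j Hj. apply in_sites in Hj.
  unfold rate. now rewrite (V_shift m c x j Hj), incr_shift, !IH.
Qed.

Lemma mx_shift m c x : (1 <= m)%nat -> mx m (shift c x) = (mx m x + c)%nat.
Proof.
  intros Hm. apply Nat.le_antisymm.
  - apply mx_lub. intros i Hi. unfold shift. pose proof (mx_ub m x i Hi). lia.
  - destruct (mx_attained m x Hm) as (i & Hi & <-). apply (mx_ub m (shift c x) i Hi).
Qed.

Definition le_on (m : nat) (x y : config) : Prop :=
  forall i, (1 <= i <= m)%nat -> (x i <= y i)%nat.

Definition mono (m : nat) (f : config -> R) : Prop :=
  forall x y, le_on m x y -> f x <= f y.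

Lemma le_on_incr m x j : le_on m x (incr x j).
Proof. intros i _. apply incr_bounds. Qed.

Lemma le_on_incr2 m x y j : le_on m x y -> le_on m (incr x j) (incr y j).
Proof. intros H i Hi. specialize (H i Hi). unfold incr. destruct (Nat.eqb i j); lia. Qed.

Lemma mono_mx m : mono m (fun x => INR (mx m x)).
Proof.
  intros x y H. apply le_INR, mx_lub. intros i Hi.
  specialize (H i Hi). pose proof (mx_ub m y i Hi). lia.
Qed.

Lemma xb_mono m x y i : le_on m x y -> (xb m x i <= xb m y i)%nat.
Proof.
  intros H. destruct (Nat.leb_spec 1 i), (Nat.leb_spec i m).
  - rewrite !xb_in by easy. now apply H.
  - rewrite !xb_out; lia.
  - rewrite !xb_out; lia.
  - rewrite !xb_out; lia.
Qed.

Lemma rate_tilde b0 b1 m x j :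
  rate b0 b1 b1 m x j =
  if (Nat.ltb (xb m x j) (xb m x (j - 1)) || Nat.ltb (xb m x j) (xb m x (j + 1)))%bool
  then b1 else b0.
Proof.
  unfold rate, V. destruct (Nat.ltb _ _), (Nat.ltb _ _); easy.
Qed.

(** With the two upper rates equal, a site only asks whether some neighbour is higher, and raising
    the other sites can only make this true. *)
Lemma rate_tilde_mono b0 b1 m x y j : b0 <= b1 -> (1 <= j <= m)%nat ->
  le_on m x y -> x j = y j -> rate b0 b1 b1 m x j <= rate b0 b1 b1 m y j.
Proof.
  intros Hb Hj Hxy E. rewrite !rate_tilde, !(xb_in _ _ j Hj), E.
  pose proof (xb_mono m x y (j - 1) Hxy). pose proof (xb_mono m x y (j + 1) Hxy).
  destruct (Nat.ltb_spec (y j) (xb m x (j - 1))), (Nat.ltb_spec (y j) (xb m x (j + 1))),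
    (Nat.ltb_spec (y j) (xb m y (j - 1))), (Nat.ltb_spec (y j) (xb m y (j + 1)));
    simpl; try lra; lia.
Qed.

(* Attractiveness: choosing a uniform site and then deciding whether it jumps, one is
   reduced to a single site. *)
Lemma mono_kern b0 b1 m f : (1 <= m)%nat -> 0 < b0 -> b0 <= b1 -> mono m f ->
  mono m (kern (unif b0 b1 b1 m) m (rate b0 b1 b1 m) f).
Proof.
  intros Hm H0 H1 Hf x y Hxy.
  assert (Hm' : 1 <= INR m) by (change 1 with (INR 1); now apply le_INR).
  set (B := b0 + b1 + b1).
  assert (Hk : forall z, kern (unif b0 b1 b1 m) m (rate b0 b1 b1 m) f z =
    lsum (sites m) (fun j => / INR m *
      (f z + rate b0 b1 b1 m z j / B * (f (incr z j) - f z)))).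
  { intros z. unfold kern, gen, unif. fold B.
    rewrite lsum_scal, lsum_plus, lsum_const, length_sites.
    rewrite (lsum_ext _ (fun j => rate b0 b1 b1 m z j / B * (f (incr z j) - f z))
      (fun j => / B * (rate b0 b1 b1 m z j * (f (incr z j) - f z))))
      by (intros; unfold Rdiv; ring).
    rewrite lsum_scal. field. unfold B; lra. }
  rewrite !Hk. apply lsum_le. intros j Hj. apply in_sites in Hj.
  apply Rmult_le_compat_l; [left; apply Rinv_0_lt_compat; lra|].
  assert (Hp : forall z, 0 <= rate b0 b1 b1 m z j / B <= 1).
  { intros z. pose proof (rate_bounds b0 b1 b1 m z j H0 H1 (Rle_refl _)).
    split; [apply Rle_mult_inv_pos; unfold B; lra|].
    apply (Rmult_le_reg_r B); [unfold B; lra|].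
    unfold Rdiv. rewrite Rmult_assoc, Rinv_l by (unfold B; lra). unfold B; lra. }
  pose proof (Hp x) as Hpx. pose proof (Hp y) as Hpy.
  pose proof (Hf _ _ Hxy) as F1.
  pose proof (Hf _ _ (le_on_incr2 m x y j Hxy)) as F2.
  pose proof (Hf _ _ (le_on_incr m y j)) as F3.
  destruct (Nat.eq_dec (x j) (y j)) as [E|E].
  - pose proof (rate_tilde_mono b0 b1 m x y j H1 Hj Hxy E) as Hr.
    apply (Rmult_le_compat_r (/ B)) in Hr;
      [|left; apply Rinv_0_lt_compat; unfold B; lra].
    fold (rate b0 b1 b1 m x j / B) (rate b0 b1 b1 m y j / B) in Hr.
    nra.
  (* Heights are integers, so [x j < y j] leaves room for a jump of the lower copy alone: the order
     survives whichever copy jumps. *)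
  - assert (F4 : f (incr x j) <= f y).
    { apply Hf. intros i Hi. specialize (Hxy i Hi).
      destruct (Nat.eq_dec i j) as [->|Hij].
      - rewrite incr_same. lia.
      - now rewrite incr_other. }
    nra.
Qed.

Lemma mono_iterk b0 b1 m N f : (1 <= m)%nat -> 0 < b0 -> b0 <= b1 -> mono m f ->
  mono m (iterk (unif b0 b1 b1 m) m (rate b0 b1 b1 m) N f).
Proof.
  intros. induction N as [|N IH]; [easy|].
  change (mono m (kern (unif b0 b1 b1 m) m (rate b0 b1 b1 m)
    (iterk (unif b0 b1 b1 m) m (rate b0 b1 b1 m) N f))).
  now apply mono_kern.
Qed.

Lemma iterk_increasing Lam m r f N N' x : uniformizable Lam m r -> mono m f ->
  (N <= N')%nat -> iterk Lam m r N f x <= iterk Lam m r N' f x.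
Proof.
  intros HU Hf HN. induction HN as [|N' HN IH]; [lra|].
  eapply Rle_trans; [apply IH|]. rewrite iterk_S'. apply iterk_le; [easy|].
  intros y _. unfold kern.
  enough (0 <= gen m r f y / Lam) by lra.
  apply Rle_mult_inv_pos; [|apply HU].
  apply lsum_nonneg. intros j _. apply Rmult_le_pos; [apply HU|].
  pose proof (Hf _ _ (le_on_incr m y j)). lra.
Qed.

(* The corrector is the average of [E_x max X_i] over [i < N]: its drift telescopes to
   [E_x max X_N - max x], which by attractiveness and translation invariance is largest
   for flat [x]. *)
Lemma tilde_corrector b0 b1 m N d : (1 <= m)%nat -> 0 < b0 -> b0 <= b1 -> (1 <= N)%nat ->
  iterk (unif b0 b1 b1 m) m (rate b0 b1 b1 m) N (fun x => INR (mx m x)) zero_config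
    <= INR N * (d / unif b0 b1 b1 m) ->
  exists phi : config -> R,
    (forall x, INR (mx m x) <= phi x <= INR (mx m x) + INR N) /\
    mono m phi /\
    (forall x j, phi (incr x j) <= phi x + 1) /\
    (forall x, gen m (rate b0 b1 b1 m) phi x <= d).
Proof.
  intros Hm H0 H1 HN Hd.
  set (Lam := unif b0 b1 b1 m) in *. set (r := rate b0 b1 b1 m) in *.
  assert (HU : uniformizable Lam m r) by (apply uniformizable_rate; lra || easy).
  assert (HL : 0 < Lam) by apply HU.
  assert (HN' : 1 <= INR N) by (change 1 with (INR 1); now apply le_INR).
  set (M := fun x => INR (mx m x)) in *.
  set (e i := iterk Lam m r i M).
  assert (Hmono : forall i, mono m (e i)) by (intros; apply mono_iterk; auto using mono_mx).
  assert (Hshift : forall i c x, e i (shift c x) = e i x + INR c).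
  { intros i c x. unfold e, r. rewrite iterk_shift.
    replace (fun y => M (shift c y)) with (fun y => 0 * 0 + M y + INR c).
    - rewrite (iterk_affine _ _ _ _ 0 (fun _ => 0) M). ring.
    - apply functional_extensionality; intros y. unfold M.
      rewrite mx_shift, plus_INR by easy. ring. }
  assert (Hup : forall i x, e i x <= M x + INR i).
  { intros i x. apply Rle_trans with (iterk Lam m r i (fun _ => M x + INR i) x).
    - apply iterk_le; [easy|]. intros y Hy. destruct (mx_reach m i x y Hy) as [_ H].
      apply le_INR in H. rewrite plus_INR in H. exact H.
    - rewrite iterk_const; lra. }
  assert (Hlow : forall i x, M x <= e i x).
  { intros i x. apply (iterk_increasing Lam m r M 0 i x HU (mono_mx m)); lia. }
  assert (Havg : forall f g, (forall i, (i < N)%nat -> f i <= g i) ->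
    / INR N * lsum (seq 0 N) f <= / INR N * lsum (seq 0 N) g).
  { intros f g H. apply Rmult_le_compat_l; [left; apply Rinv_0_lt_compat; lra|].
    apply lsum_le. intros i Hi. apply in_seq in Hi. apply H; lia. }
  assert (Hcst : forall c, / INR N * lsum (seq 0 N) (fun _ => c) = c).
  { intros c. rewrite lsum_const, length_seq. field; lra. }
  exists (fun x => / INR N * lsum (seq 0 N) (fun i => e i x)). repeat split.
  - rewrite <- (Hcst (INR (mx m x))). apply Havg. intros i _. apply Hlow.
  - rewrite <- (Hcst (INR (mx m x) + INR N)). apply Havg. intros i Hi.
    eapply Rle_trans; [apply Hup|]. apply lt_INR in Hi. unfold M; lra.
  - intros x y Hxy. apply Havg. intros i _. now apply Hmono.
  - intros x j.
    replace (/ INR N * lsum (seq 0 N) (fun i => e i x) + 1)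
      with (/ INR N * lsum (seq 0 N) (fun i => e i x + 1))
      by (rewrite lsum_plus, Rmult_plus_distr_l, Hcst; easy).
    apply Havg. intros i _.
    (* A single jump is dominated by raising all sites by one, which adds exactly 1 to each
       [e i]. *)
    change 1 with (INR 1). rewrite <- Hshift. apply Hmono.
    intros i' _. apply incr_bounds.
  - intros x. rewrite gen_scal.
    assert (Hg : gen m r (fun x => lsum (seq 0 N) (fun i => e i x)) x
                 = Lam * (e N x - M x)).
    { clear -HL. induction N as [|N IH].
      - simpl. rewrite gen_const. unfold e, iterk; simpl. ring.
      - rewrite seq_S. simpl plus.
        assert ((fun y => lsum (seq 0 N ++ N :: nil) (fun i => e i y)) =
                (fun y => lsum (seq 0 N) (fun i => e i y) + e N y)) as ->.
        { apply functional_extensionality; intros y. rewrite lsum_app. simpl. lra. }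
        rewrite gen_plus, IH. unfold e at 3. rewrite iterk_S. unfold kern.
        fold (e N). field. lra. }
    rewrite Hg.
    assert (He : e N x <= M x + INR N * (d / Lam)).
    { apply Rle_trans with (e N (shift (mx m x) zero_config)).
      - apply Hmono. intros i Hi. unfold shift, zero_config. now apply mx_ub.
      - rewrite Hshift. unfold M at 1. unfold e. lra. }
    apply (Rmult_le_reg_l (INR N)); [lra|].
    rewrite <- Rmult_assoc, Rinv_r, Rmult_1_l by lra.
    apply Rle_trans with (Lam * (INR N * (d / Lam))).
    + apply Rmult_le_compat_l; lra.
    + right. field. lra.
Qed.

(** * From Poisson mixtures to the discrete chain *)

Definition dexp (d : Defs.dist) (f : config -> R) : R := lsum d (fun p => fst p * f (snd p)).

(** [ustep] moves weighted configurations forward and [kern] acts on functions; this duality trades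
    the growing lists for iterates of one operator. *)
Lemma dexp_ustep b0 b1 b2 m d f : unif b0 b1 b2 m <> 0 ->
  dexp (ustep b0 b1 b2 m d) f =
  dexp d (kern (unif b0 b1 b2 m) m (rate b0 b1 b2 m) f).
Proof.
  intros HL. unfold dexp, ustep. rewrite lsum_flat_map.
  apply lsum_ext. intros [w x] _. simpl. rewrite lsum_map. simpl.
  rewrite kern_weights by easy.
  rewrite (lsum_ext _ (fun a => w * (rate b0 b1 b2 m x a / unif b0 b1 b2 m) * f (incr x a))
    (fun a => w * (rate b0 b1 b2 m x a / unif b0 b1 b2 m * f (incr x a)))) by (intros; ring).
  rewrite lsum_scal.
  change (lsum (sites m) (rate b0 b1 b2 m x)) with (total_rate b0 b1 b2 m x). ring.
Qed.

Lemma dexp_udist b0 b1 b2 m N f : unif b0 b1 b2 m <> 0 ->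
  dexp (udist b0 b1 b2 m N) f =
  iterk (unif b0 b1 b2 m) m (rate b0 b1 b2 m) N f zero_config.
Proof.
  intros HL. revert f; induction N as [|N IH]; intros f.
  - unfold dexp, udist, iterk. simpl. ring.
  - change (udist b0 b1 b2 m (S N)) with (ustep b0 b1 b2 m (udist b0 b1 b2 m N)).
    now rewrite dexp_ustep, IH, iterk_S'.
Qed.

Lemma mass_of_dexp E d : mass_of E d = dexp d (fun x => if E x then 1 else 0).
Proof.
  unfold mass_of, dexp. induction d as [|p d IH]; simpl; [easy|].
  rewrite IH. destruct (E (snd p)); lra.
Qed.

Lemma partial_sum_le (a : nat -> R) l K :
  (forall j, 0 <= a j) -> infinite_sum a l -> sum_f_R0 a K <= l.
Proof. intros Ha Hl. apply sum_incr; [exact Hl|easy]. Qed.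

Lemma exp_series u : infinite_sum (fun j => / INR (fact j) * u ^ j) (exp u).
Proof. unfold exp. destruct (exist_exp u) as [l Hl]. exact Hl. Qed.

(** A Chernoff bound: for [j <= N], [mu ^ j] is at most [N ^ j / theta ^ N], so the tail is at most
    [exp (- N * c)] with the large deviation rate [c = / theta - 1 + ln theta > 0]. *)
Lemma poisson_lower_tail theta : 0 < theta < 1 ->
  exists N1 : nat, (1 <= N1)%nat /\ forall N mu, (N1 <= N)%nat -> mu = INR N / theta ->
    exp (- mu) * sum_f_R0 (fun j => / INR (fact j) * mu ^ j) (N - 1) <= 1 / 4.
Proof.
  intros Ht. set (c := / theta - 1 + ln theta).
  assert (Hc : 0 < c).
  { assert (Hit : 1 < / theta) by (rewrite <- Rinv_1; apply Rinv_lt_contravar; lra).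
    assert (Hln : 0 < ln (/ theta)) by (rewrite <- ln_1; apply ln_increasing; lra).
    pose proof (exp_ineq1 (ln (/ theta))) as H.
    rewrite exp_ln, ln_Rinv in * by lra. unfold c. lra. }
  destruct (INR_unbounded (3 / c)) as (N1 & HN1).
  exists (S N1). split; [lia|]. intros N mu HN ->.
  assert (HNc : 3 <= INR N * c).
  { apply le_INR in HN. rewrite S_INR in HN.
    apply Rle_trans with (3 / c * c); [right; field; lra|].
    apply Rmult_le_compat_r; lra. }
  apply Rle_trans with (exp (- (INR N / theta)) * (exp (- (INR N * ln theta)) * exp (INR N))).
  - apply Rmult_le_compat_l; [left; apply exp_pos|].
    apply Rle_trans with (exp (- (INR N * ln theta)) *
      sum_f_R0 (fun j => / INR (fact j) * INR N ^ j) (N - 1)).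
    + rewrite scal_sum. apply sum_Rle. intros j Hj.
      rewrite (Rmult_assoc (/ INR (fact j))).
      apply Rmult_le_compat_l; [left; apply Rinv_0_lt_compat, INR_fact_lt_0|].
      unfold Rdiv. rewrite Rpow_mult_distr, pow_inv.
      apply Rmult_le_compat_l; [apply pow_le, pos_INR|].
      assert (Hpj : 0 < theta ^ j) by (apply pow_lt; lra).
      rewrite <- (exp_ln (/ theta ^ j)) by now apply Rinv_0_lt_compat.
      apply exp_le. rewrite ln_Rinv by easy.
      rewrite ln_pow by lra.
      assert (ln theta <= 0) by (rewrite <- ln_1; apply ln_le; lra).
      assert (INR j <= INR N) by (apply le_INR; lia). nra.
    + apply Rmult_le_compat_l; [left; apply exp_pos|].
      apply partial_sum_le; [|apply exp_series].
      intros j. apply Rmult_le_pos; [left; apply Rinv_0_lt_compat, INR_fact_lt_0|].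
      apply pow_le, pos_INR.
  - rewrite <- !exp_plus.
    replace (- (INR N / theta) + (- (INR N * ln theta) + INR N)) with (- (INR N * c))
      by (unfold c; field; lra).
    rewrite exp_Ropp. pose proof (exp_ineq1_le (INR N * c)).
    replace (1 / 4) with (/ 4) by lra. apply Rinv_le_contravar; lra.
Qed.

(** The clock is run until the mean [N / theta] exceeds [N]. Indices up to some [K + N] carry mass
    at least 3/4 and those below [N] at most 1/4, so at least half of the mass sits where [a] is at
    least [a N]. *)
Lemma depoissonize theta : 0 < theta < 1 ->
  exists N1 : nat, (1 <= N1)%nat /\ forall N lam t a p, (N1 <= N)%nat ->
    lam * t = INR N / theta -> (forall i j, (i <= j)%nat -> a i <= a j) ->
    (forall j, 0 <= a j) -> infinite_sum (fun j => poisson lam t j * a j) p ->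
    a N <= 2 * p.
Proof.
  intros Ht. destruct (poisson_lower_tail theta Ht) as (N1 & HN1 & Htail).
  exists N1. split; [easy|]. intros N lam t a p HN Hmu Hmono Hpos Hp.
  specialize (Htail N (lam * t) HN Hmu). set (mu := lam * t) in *.
  assert (Hmu0 : 0 < mu).
  { rewrite Hmu. apply Rdiv_lt_0_compat; [apply lt_0_INR; lia|lra]. }
  set (q j := exp (- mu) * (/ INR (fact j) * mu ^ j)).
  assert (Hq : forall j, 0 <= q j).
  { intros j. unfold q. apply Rmult_le_pos; [left; apply exp_pos|].
    apply Rmult_le_pos; [left; apply Rinv_0_lt_compat, INR_fact_lt_0|].
    apply pow_le; lra. }
  assert (Hqp : forall j, poisson lam t j = q j).
  { intros j. unfold poisson, q, Rdiv. fold mu. ring. }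
  assert (HqS : forall K, sum_f_R0 q K =
    exp (- mu) * sum_f_R0 (fun j => / INR (fact j) * mu ^ j) K).
  { intros K. rewrite scal_sum. apply sum_eq. intros; unfold q; ring. }
  destruct (exp_series mu (exp mu / 4)) as (K & HK).
  { pose proof (exp_pos mu); lra. }
  specialize (HK (K + N)%nat ltac:(lia)).
  assert (Hbig : 3 / 4 <= sum_f_R0 q (K + N)).
  { rewrite HqS. unfold Rdist in HK. apply Rabs_def2 in HK.
    rewrite exp_Ropp. pose proof (exp_pos mu).
    apply Rle_trans with (/ exp mu * (exp mu * (3 / 4))); [right; field; lra|].
    apply Rmult_le_compat_l; [left; apply Rinv_0_lt_compat|]; lra. }
  rewrite (tech2 q (N - 1) (K + N)) in Hbig by lia.
  rewrite HqS in Hbig.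
  assert (Hpart : sum_f_R0 (fun j => poisson lam t j * a j) (K + N) <= p).
  { apply partial_sum_le; [|easy]. intros j. rewrite Hqp. now apply Rmult_le_pos. }
  rewrite (tech2 _ (N - 1) (K + N)) in Hpart by lia.
  assert (H0 : 0 <= sum_f_R0 (fun j => poisson lam t j * a j) (N - 1)).
  { apply cond_pos_sum. intros j. rewrite Hqp. now apply Rmult_le_pos. }
  set (K' := (K + N - S (N - 1))%nat) in *.
  assert (H1 : a N * sum_f_R0 (fun i => q (S (N - 1) + i)%nat) K' <=
     sum_f_R0 (fun i => poisson lam t (S (N - 1) + i) * a (S (N - 1) + i)%nat) K').
  { rewrite scal_sum. apply sum_Rle. intros j _. rewrite Hqp.
    apply Rmult_le_compat_l; [easy|]. apply Hmono. lia. }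
  specialize (Hpos N). nra.
Qed.

(** The maximum is at most the last site plus the range. The last site is below [d * t] except on an
    event of small probability, where it is still at most [N]; the range is of order the square root
    of [N] in mean, hence invisible at the scale of speeds. *)
Lemma tilde_speed_reached b0 b1 b2 m d : (1 <= m)%nat -> 0 < b0 < b1 -> d < b2 ->
  tilde_D m b0 b1 d ->
  exists N d', (1 <= N)%nat /\ 0 < d' < b2 /\
    iterk (unif b0 b1 b1 m) m (rate b0 b1 b1 m) N (fun x => INR (mx m x)) zero_config
      <= INR N * (d' / unif b0 b1 b1 m).
Proof.
  intros Hm Hb Hd (Hd0 & C & al & HC & Hal & Hdecay).
  set (Lam := unif b0 b1 b1 m) in *. set (r := rate b0 b1 b1 m) in *.
  assert (HU : uniformizable Lam m r) by (apply uniformizable_rate; lra || easy).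
  assert (HL : 0 < Lam) by apply HU.
  (* Speed budget: one [g] for the change of clock, one for the exceptional event, one for the
     range; the last keeps [d + 3 * g] below [b2]. *)
  set (g := (b2 - d) / 4). assert (Hg : 0 < g) by (unfold g; lra).
  (* With [Lam * t = N / theta], the level [d * t] becomes [N * ((d + g) / Lam)]. *)
  set (theta := d / (d + g)).
  assert (Htheta : 0 < theta < 1).
  { unfold theta. split; [apply Rdiv_lt_0_compat; lra|].
    apply (Rmult_lt_reg_r (d + g)); [lra|]. unfold Rdiv. rewrite Rmult_assoc, Rinv_l; lra. }
  destruct (depoissonize theta Htheta) as (N1 & HN1 & Hdep).
  destruct (tilde_rng_square b0 b1 m Hm Hb) as (T & Cs & HT & HCs & Hsq).
  fold Lam r in Hsq.
  assert (HT' : 1 <= INR T) by (change 1 with (INR 1); now apply le_INR).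
  (* The weight in the bound of [rng] by [rng * rng / (2 * a) + a / 2], chosen so that the second
     moment costs exactly [N * (g / (2 * Lam))]. [N2] brings [a / 2] below the same cost, and [N3]
     brings [2 * p] below [g / Lam]. *)
  set (a := Cs * Lam / (INR T * g)).
  assert (Ha : 0 < a) by (unfold a; apply Rdiv_lt_0_compat; nra).
  destruct (INR_unbounded (a * Lam / g)) as (N2 & HN2).
  destruct (INR_unbounded (2 * C * Lam / g * theta * Lam / al)) as (N3 & HN3).
  set (j := (N1 + N2 + N3)%nat). set (N := (j * T)%nat).
  assert (HjN : (j <= N)%nat) by (unfold N; nia).
  assert (HNj : INR N = INR j * INR T) by apply mult_INR.
  assert (HN0 : 1 <= INR N) by (change 1 with (INR 1); apply le_INR; lia).
  exists N, (d + 3 * g). split; [lia|]. split; [unfold g; lra|].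
  set (t := INR N / (theta * Lam)).
  assert (Ht : 0 < t) by (unfold t; apply Rdiv_lt_0_compat; nra).
  destruct (Hdecay t) as (p & Hp & Hple); [lra|].
  set (I := fun x : config => if last_ge m d t x then 1 else 0).
  assert (HI : mono m I).
  { intros x y Hxy. assert (INR (x m) <= INR (y m)) by (apply le_INR, Hxy; lia).
    unfold I, last_ge. destruct (Rle_dec (d * t) (INR (x m))), (Rle_dec (d * t) (INR (y m)));
      lra. }
  assert (HI0 : forall x, 0 <= I x) by (intros; unfold I; destruct (last_ge m d t x); lra).
  assert (Hq : iterk Lam m r N I zero_config <= 2 * p).
  { apply (Hdep N Lam t (fun i => iterk Lam m r i I zero_config)).
    - lia.
    - unfold t. field. lra.
    - intros i i' Hi. now apply iterk_increasing.
    - intros i. rewrite <- (iterk_const Lam m r i 0 zero_config).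
      apply iterk_le; auto.
    - unfold crystal_prob in Hp. fold Lam in Hp.
      intros eps Heps. destruct (Hp eps Heps) as (K & HK). exists K. intros n Hn.
      rewrite <- (sum_eq (fun n => poisson Lam t n * mass_of (last_ge m d t) (udist b0 b1 b1 m n))).
      + now apply HK.
      + intros i _. rewrite mass_of_dexp, dexp_udist; [easy|]. fold Lam. lra. }
  assert (Hp' : 2 * p <= g / Lam).
  { assert (Hex : exp (- (al * t)) <= / (al * t)).
    { rewrite exp_Ropp. pose proof (exp_ineq1_le (al * t)).
      apply Rinv_le_contravar; nra. }
    assert (Hal' : 2 * C * Lam / g <= al * t).
    { unfold t. assert (INR N3 <= INR N) by (apply le_INR; unfold j in HjN; lia).
      apply (Rmult_le_reg_r (theta * Lam / al)); [apply Rdiv_lt_0_compat; nra|].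
      replace (al * (INR N / (theta * Lam)) * (theta * Lam / al)) with (INR N)
        by (field; lra).
      replace (2 * C * Lam / g * (theta * Lam / al)) with (2 * C * Lam / g * theta * Lam / al)
        by (field; lra).
      lra. }
    assert (Hpos : 0 < 2 * C * Lam / g) by (apply Rdiv_lt_0_compat; nra).
    apply Rinv_le_contravar in Hal'; [|easy].
    apply Rle_trans with (2 * (C * / (2 * C * Lam / g))).
    - assert (C * exp (- (al * t)) <= C * / (2 * C * Lam / g)) by
        (apply Rmult_le_compat_l; lra). lra.
    - right. field. lra. }
  apply Rle_trans with (iterk Lam m r N (fun x => INR N * I x +
    (1 / (2 * a) * (rng m x * rng m x) + (d * t + a / 2)) + 0) zero_config).
  - apply iterk_le; [easy|]. intros y Hy. rewrite Rplus_0_r.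
    assert (Hamgm : rng m y <= 1 / (2 * a) * (rng m y * rng m y) + a / 2).
    { assert (0 <= (rng m y - a) * (rng m y - a) / (2 * a)).
      { apply Rle_mult_inv_pos; [|lra]. apply Rle_0_sqr. }
      replace (1 / (2 * a) * (rng m y * rng m y) + a / 2)
        with ((rng m y - a) * (rng m y - a) / (2 * a) + rng m y) by (field; lra).
      lra. }
    assert (Hlast : INR (y m) <= INR N * I y + d * t).
    { unfold I, last_ge. destruct (Rle_dec (d * t) (INR (y m))) as [H|H].
      - assert (INR (y m) <= INR N) by (apply le_INR; specialize (Hy m);
          unfold zero_config in Hy; lia). nra.
      - lra. }
    assert (Hmn : INR (mn m y) <= INR (y m)) by (apply le_INR, mn_lb; lia).
    unfold rng in *. lra.
  - rewrite (iterk_affine Lam m r N (INR N) I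
      (fun x => 1 / (2 * a) * (rng m x * rng m x) + (d * t + a / 2)) 0).
    rewrite (functional_extensionality
      (fun x => 1 / (2 * a) * (rng m x * rng m x) + (d * t + a / 2))
      (fun x => 1 / (2 * a) * (rng m x * rng m x) + (fun _ => 0) x + (d * t + a / 2)))
      by (intros; lra).
    rewrite iterk_affine, iterk_const.
    specialize (Hsq j). fold N in Hsq.
    assert (E1 : INR N * iterk Lam m r N I zero_config <= INR N * (g / Lam)).
    { apply Rmult_le_compat_l; lra. }
    assert (E2 : 1 / (2 * a) * iterk Lam m r N (fun x => rng m x * rng m x) zero_config
                 <= INR N * (g / (2 * Lam))).
    { apply Rle_trans with (1 / (2 * a) * (INR j * Cs)).
      - apply Rmult_le_compat_l; [apply Rle_mult_inv_pos; lra|easy].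
      - right. rewrite HNj. unfold a. field. lra. }
    assert (E3 : a / 2 <= INR N * (g / (2 * Lam))).
    { assert (INR N2 <= INR N) by (apply le_INR; unfold j in HjN; lia).
      apply Rle_trans with (a * Lam / g * (g / (2 * Lam))).
      - right. field. lra.
      - apply Rmult_le_compat_r; [apply Rle_mult_inv_pos; lra|lra]. }
    assert (E4 : d * t = INR N * ((d + g) / Lam)).
    { unfold t, theta. field. lra. }
    replace (INR N * ((d + 3 * g) / Lam)) with
      (INR N * (g / Lam) + (INR N * (g / (2 * Lam)) + INR N * (g / (2 * Lam)))
       + INR N * ((d + g) / Lam)) by (field; lra).
    lra.
Qed.

(** * Blocks between low sites *)

(** Padding with the floor [M] lets the single function [phi] for [n] sites serve shorter blocks as
    well. *)
Definition embed (M o l : nat) (x : config) : config :=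
  fun i => if (Nat.leb 1 i && Nat.leb i l)%bool then Nat.max (x (o + i)%nat) M else M.

Lemma embed_in M o l x i : (1 <= i <= l)%nat -> embed M o l x i = Nat.max (x (o + i)%nat) M.
Proof.
  intros [H1 H2]. unfold embed. apply Nat.leb_le in H1, H2. now rewrite H1, H2.
Qed.

Lemma embed_ge M o l x i : (M <= embed M o l x i)%nat.
Proof. unfold embed. destruct (_ && _)%bool; lia. Qed.

Lemma embed_incr_const M o l x j : (x j < M)%nat \/ ~ (o < j <= o + l)%nat ->
  embed M o l (incr x j) = embed M o l x.
Proof.
  intros H. apply functional_extensionality; intros i. unfold embed.
  destruct (Nat.leb_spec 1 i), (Nat.leb_spec i l); simpl; try easy.
  destruct (Nat.eq_dec (o + i) j) as [<-|E].
  - rewrite incr_same. lia.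
  - now rewrite incr_other.
Qed.

Lemma embed_incr M o l x i : (1 <= i <= l)%nat -> (M <= x (o + i)%nat)%nat ->
  embed M o l (incr x (o + i)) = incr (embed M o l x) i.
Proof.
  intros Hi HM. apply functional_extensionality; intros i'.
  destruct (Nat.eq_dec i' i) as [->|E].
  - rewrite incr_same, !embed_in, incr_same by easy. lia.
  - rewrite (incr_other _ i) by easy. unfold embed. rewrite incr_other by lia. easy.
Qed.

(* Sites below [M] are invisible in [embed M o l x], so their fast motion is harmless. *)
Lemma gen_embed b0 b1 b2 n k phi M o l y : 0 < b0 -> b0 <= b2 -> b2 <= b1 ->
  mono n phi -> (l <= n)%nat -> (o + l <= k)%nat ->
  ((1 <= o)%nat -> (y o <= M)%nat) ->
  ((o + l + 1 <= k)%nat -> (y (o + l + 1)%nat <= M)%nat) ->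
  gen k (rate b0 b1 b2 k) (fun x => phi (embed M o l x)) y <=
  gen n (rate b0 b1 b1 n) phi (embed M o l y).
Proof.
  intros H0 H02 H21 Hphi Hl Hk Hleft Hright. unfold gen.
  set (z := embed M o l y).
  assert (Hsplit : forall f, lsum (sites k) f = lsum (seq 1 o) f + lsum (seq 1 l) (fun i => f (o + i)%nat)
            + lsum (seq (S (o + l)) (k - o - l)) f).
  { intros f. rewrite <- (lsum_seq_shift o l f), <- !lsum_app, <- app_assoc. unfold sites.
    change (S (o + l)) with (S o + l)%nat. rewrite <- (seq_app l (k - o - l) (S o)).
    change (S o) with (1 + o)%nat. rewrite <- (seq_app o _ 1).
    f_equal. f_equal. lia. }
  rewrite Hsplit.
  rewrite (lsum_ext (seq 1 o) _ (fun _ => 0)).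
  2:{ intros j Hj. apply in_seq in Hj. rewrite embed_incr_const by lia. fold z. ring. }
  rewrite (lsum_ext (seq (S (o + l)) _) _ (fun _ => 0)).
  2:{ intros j Hj. apply in_seq in Hj. rewrite embed_incr_const by lia. fold z. ring. }
  rewrite !lsum_const, !Rmult_0_r, Rplus_0_l, Rplus_0_r.
  replace (sites n) with (seq 1 l ++ seq (1 + l) (n - l))
    by (unfold sites; rewrite <- seq_app; f_equal; lia).
  rewrite lsum_app.
  assert (Hrest : forall l', 0 <= lsum l' (fun i => rate b0 b1 b1 n z i * (phi (incr z i) - phi z))).
  { intros l'. apply lsum_nonneg. intros i _.
    pose proof (rate_bounds b0 b1 b1 n z i).
    pose proof (Hphi _ _ (le_on_incr n z i)). apply Rmult_le_pos; lra. }
  specialize (Hrest (seq (1 + l) (n - l))).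
  enough (lsum (seq 1 l) (fun i => rate b0 b1 b2 k y (o + i)
             * (phi (embed M o l (incr y (o + i))) - phi z))
          <= lsum (seq 1 l) (fun i => rate b0 b1 b1 n z i * (phi (incr z i) - phi z))) by lra.
  apply lsum_le. intros i Hi. apply in_seq in Hi.
  pose proof (rate_bounds b0 b1 b1 n z i).
  pose proof (rate_bounds b0 b1 b2 k y (o + i)).
  pose proof (Hphi _ _ (le_on_incr n z i)).
  destruct (Nat.lt_ge_cases (y (o + i)%nat) M) as [Hlow|Hhigh].
  - rewrite embed_incr_const by (left; easy). fold z.
    apply Rle_trans with 0; [right; ring|apply Rmult_le_pos; lra].
  - rewrite embed_incr by (lia || easy). fold z.
    apply Rmult_le_compat_r; [lra|].
    assert (Hzi : z i = y (o + i)%nat) by (unfold z; rewrite embed_in; lia).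
    (* A neighbour strictly higher than a site at or above [M] cannot be a flanking site, so it lies
       in the block and survives the embedding; the right-hand rate is then [b1], the largest one.
       Without a higher neighbour the left-hand rate is [b0], the smallest. *)
    destruct (Nat.lt_ge_cases (xb k y (o + i)) (xb k y (o + i - 1))) as [H4|H4].
    { apply Rle_trans with b1; [lra|].
      apply rate_pushed; [lra|]. left.
      rewrite (xb_in k) in H4 by lia. rewrite xb_in, Hzi by lia.
      assert (1 <= o + i - 1 <= k)%nat as Hb.
      { destruct (Nat.leb_spec 1 (o + i - 1)), (Nat.leb_spec (o + i - 1) k); try easy;
          rewrite xb_out in H4; lia. }
      rewrite (xb_in k) in H4 by easy.
      destruct (Nat.eq_dec i 1) as [->|Hi1].
      - replace (o + 1 - 1)%nat with o in * by lia. specialize (Hleft ltac:(lia)). lia.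
      - rewrite xb_in by lia. unfold z. rewrite embed_in by lia.
        replace (o + (i - 1))%nat with (o + i - 1)%nat by lia. lia. }
    destruct (Nat.lt_ge_cases (xb k y (o + i)) (xb k y (o + i + 1))) as [H5|H5].
    { apply Rle_trans with b1; [lra|].
      apply rate_pushed; [lra|]. right.
      rewrite (xb_in k) in H5 by lia. rewrite xb_in, Hzi by lia.
      assert (1 <= o + i + 1 <= k)%nat as Hb.
      { destruct (Nat.leb_spec 1 (o + i + 1)), (Nat.leb_spec (o + i + 1) k); try easy;
          rewrite xb_out in H5; lia. }
      rewrite (xb_in k) in H5 by easy.
      destruct (Nat.eq_dec i l) as [->|Hil].
      - specialize (Hright ltac:(lia)). lia.
      - rewrite xb_in by lia. unfold z. rewrite embed_in by lia.
        replace (o + (i + 1))%nat with (o + i + 1)%nat by lia. lia. }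
    rewrite rate_top by easy. lra.
Qed.

(** The flanking sites are constrained only where they exist: past an end of the crystal the
    boundary value 0 plays their part. *)
Definition separated (M k n : nat) (gs : list (nat * nat)) (y : config) : Prop :=
  forall o l, In (o, l) gs ->
    (l <= n)%nat /\ (o + l <= k)%nat /\ ((1 <= o)%nat -> (y o <= M)%nat) /\
    ((o + l + 1 <= k)%nat -> (y (o + l + 1)%nat <= M)%nat).

Definition covered (M k : nat) (gs : list (nat * nat)) (y : config) : Prop :=
  forall i, (1 <= i <= k)%nat ->
    (y i <= M)%nat \/ exists o l, In (o, l) gs /\ (o < i <= o + l)%nat.

(* The pair [(o, l)] stands for the block of sites [o + 1, ..., o + l]. *)
Lemma blocks_upper_function b0 b1 b2 n phi d C0 eps :
  0 < b0 -> b0 <= b2 -> b2 <= b1 -> (1 <= n)%nat ->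
  (forall x, INR (mx n x) <= phi x <= INR (mx n x) + C0) ->
  mono n phi -> (forall x j, phi (incr x j) <= phi x + 1) ->
  0 < d -> (forall x, gen n (rate b0 b1 b1 n) phi x <= d) -> 0 < eps ->
  exists C, forall M k gs, (1 <= length gs <= 2)%nat ->
    exists up : config -> R,
      (forall y, separated M k n gs y -> covered M k gs y -> INR (mx k y) <= up y) /\
      (forall y, separated M k n gs y -> (mx k y <= M)%nat -> up y <= INR M + C) /\
      (forall y, separated M k n gs y -> gen k (rate b0 b1 b2 k) up y <= d + eps).
Proof.
  intros H0 H02 H21 Hn Hphi Hmono Hincr Hd Hdrift Heps.
  set (s := Rmin (1 / 2) (eps / (2 * d))).
  assert (Hs : 0 < s) by (apply Rmin_pos; [lra|apply Rdiv_lt_0_compat; lra]).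
  assert (Hs1 : s <= 1 / 2) by apply Rmin_l.
  assert (Hs2 : 2 * s * d <= eps).
  { apply Rle_trans with (2 * (eps / (2 * d)) * d).
    - apply Rmult_le_compat_r; [lra|]. apply Rmult_le_compat_l; [lra|apply Rmin_r].
    - right; field; lra. }
  (* [C0] is the error of [phi], and [/ s * ln 2] that of the soft maximum over at most two blocks.
     The constant precedes [M], [k] and [gs] because the number of steps must be fixed before the
     configuration. *)
  exists (C0 + / s * ln 2). intros M k gs Hgs.
  set (f := fun (g : nat * nat) y => phi (embed M (fst g) (snd g) y)).
  set (S := fun y => lsum gs (fun g => exp (s * f g y))).
  assert (Hterm : forall y g, In g gs -> exp (s * f g y) <= S y).
  { intros y g Hg. apply (lsum_ge_term gs (fun g => exp (s * f g y))); [|easy].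
    intros g' _. left; apply exp_pos. }
  assert (Hex : exists g, In g gs).
  { destruct gs as [|g gs']; [simpl in Hgs; lia|]. exists g. now left. }
  assert (HS : forall y, 0 < S y).
  { intros y. destruct Hex as (g & Hg).
    eapply Rlt_le_trans; [|apply (Hterm y g Hg)]. apply exp_pos. }
  assert (Hflow : forall y g, In g gs -> f g y <= / s * ln (S y)).
  { intros y g Hg. apply (Rmult_le_reg_l s); [easy|].
    rewrite <- Rmult_assoc, Rinv_r, Rmult_1_l by lra.
    rewrite <- (ln_exp (s * f g y)). apply ln_le; [apply exp_pos|auto]. }
  exists (fun y => / s * ln (S y)). repeat split.
  - intros y Hsep Hcov. destruct (Nat.eq_dec k 0) as [->|Hk].
    { destruct Hex as (g & Hg). apply Rle_trans with (f g y); [|auto]. unfold f.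
      pose proof (Hphi (embed M (fst g) (snd g) y)). simpl.
      pose proof (pos_INR (mx n (embed M (fst g) (snd g) y))). lra. }
    destruct (mx_attained k y) as (i & Hi & <-); [lia|].
    destruct (Hcov i Hi) as [Hlow|(o & l & Hg & Hil)].
    + destruct Hex as (g & Hg). apply Rle_trans with (f g y); [|auto].
      eapply Rle_trans; [|apply Hphi]. apply le_INR.
      apply Nat.le_trans with (embed M (fst g) (snd g) y 1%nat).
      * pose proof (embed_ge M (fst g) (snd g) y 1%nat). lia.
      * apply mx_ub; lia.
    + apply Rle_trans with (f (o, l) y); [|auto].
      eapply Rle_trans; [|apply Hphi]. apply le_INR. simpl.
      destruct (Hsep o l Hg) as (Hl & _).
      apply Nat.le_trans with (embed M o l y (i - o)%nat); [|apply mx_ub; lia].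
      rewrite embed_in by lia. replace (o + (i - o))%nat with i by lia. lia.
  - intros y Hsep HM.
    apply (Rmult_le_reg_l s); [easy|].
    replace (s * (INR M + (C0 + / s * ln 2))) with (ln 2 + s * (INR M + C0)) by (field; lra).
    rewrite <- Rmult_assoc, Rinv_r, Rmult_1_l by lra.
    rewrite <- (ln_exp (s * (INR M + C0))), <- ln_mult by (apply exp_pos || lra).
    apply ln_le; [easy|]. unfold S.
    apply Rle_trans with (INR (length gs) * exp (s * (INR M + C0))).
    + apply lsum_le_const. intros [o l] Hg. apply exp_le.
      apply Rmult_le_compat_l; [lra|]. unfold f; simpl.
      destruct (Hsep o l Hg) as (Hl & Hol & _).
      eapply Rle_trans; [apply Hphi|]. apply Rplus_le_compat_r. apply le_INR, mx_lub.
      intros i Hi. unfold embed. destruct (Nat.leb_spec 1 i), (Nat.leb_spec i l); simpl; try lia.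
      pose proof (mx_ub k y (o + i)). lia.
    + apply Rmult_le_compat_r; [left; apply exp_pos|].
      change 2 with (INR 2). apply le_INR; lia.
  - intros y Hsep. rewrite gen_scal.
    set (r := rate b0 b1 b2 k).
    assert (Hr : forall j, 0 <= r y j).
    { intros j. pose proof (rate_bounds b0 b1 b2 k y j). unfold r; lra. }
    (* Increments [u] in [0, 1] satisfy [u * u <= u], so [exp (s * u) - 1] is at most
       [s * (1 + 2 * s) * u] and the drift stays proportional to that of [phi]. *)
    assert (HD : forall g j, 0 <= f g (incr y j) - f g y <= 1).
    { intros g j. unfold f.
      set (o := fst g). set (l := snd g).
      pose proof (Hmono _ _ (le_on_incr n (embed M o l y) (j - o)%nat)).
      pose proof (Hincr (embed M o l y) (j - o)%nat).
      destruct (Nat.lt_ge_cases (y j) M); [rewrite embed_incr_const by lia; lra|].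
      destruct (Nat.le_gt_cases j o); [rewrite embed_incr_const by lia; lra|].
      destruct (Nat.le_gt_cases j (o + l)); [|rewrite embed_incr_const by lia; lra].
      pose proof (embed_incr M o l y (j - o)%nat) as E.
      replace (o + (j - o))%nat with j in E by lia. rewrite E by lia. lra. }
    pose proof (gen_ln k r S y Hr HS) as Hg.
    assert (HgS : gen k r S y <= s * (1 + 2 * s) * d * S y).
    { unfold gen, S. rewrite <- (lsum_scal gs).
      rewrite (lsum_ext (sites k) _ (fun j => lsum gs (fun g =>
        r y j * (exp (s * f g (incr y j)) - exp (s * f g y))))).
      2:{ intros j _. rewrite lsum_scal. f_equal.
          rewrite (lsum_ext gs (fun g => exp (s * f g (incr y j)) - exp (s * f g y))
            (fun g => exp (s * f g (incr y j)) + (-1) * exp (s * f g y))) by (intros; ring).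
          rewrite lsum_plus, lsum_scal. ring. }
      rewrite lsum_swap. apply lsum_le. intros [o l] Hol.
      destruct (Hsep o l Hol) as (Hl & Hk & Hleft & Hright).
      apply Rle_trans with (exp (s * f (o, l) y) * (s * (1 + 2 * s)) * gen k r (f (o, l)) y).
      - unfold gen. rewrite <- lsum_scal. apply lsum_le. intros j _.
        specialize (HD (o, l) j).
        set (u := f (o, l) (incr y j) - f (o, l) y) in *.
        replace (f (o, l) (incr y j)) with (u + f (o, l) y) by (unfold u; ring).
        rewrite Rmult_plus_distr_l, exp_plus.
        pose proof (exp_pos (s * f (o, l) y)) as He.
        pose proof (exp_le_quadratic (s * u) ltac:(nra)) as Hq.
        assert (Hq' : exp (s * u) - 1 <= s * (1 + 2 * s) * u).
        { assert (s * s * (u * u) <= s * s * u) by (apply Rmult_le_compat_l; nra). nra. }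
        apply Rle_trans with (r y j * exp (s * f (o, l) y) * (s * (1 + 2 * s) * u)).
        + replace (r y j * (exp (s * u) * exp (s * f (o, l) y) - exp (s * f (o, l) y)))
            with (r y j * exp (s * f (o, l) y) * (exp (s * u) - 1)) by ring.
          apply Rmult_le_compat_l; [|easy]. apply Rmult_le_pos; [easy|lra].
        + right; ring.
      - replace (s * (1 + 2 * s) * d * exp (s * f (o, l) y))
          with (exp (s * f (o, l) y) * (s * (1 + 2 * s)) * d) by ring.
        pose proof (exp_pos (s * f (o, l) y)).
        apply Rmult_le_compat_l; [apply Rmult_le_pos; nra|].
        eapply Rle_trans; [|apply (Hdrift (embed M o l y))].
        now apply (gen_embed b0 b1 b2 n k phi M o l y). }
    apply (Rmult_le_reg_l s); [easy|]. rewrite <- Rmult_assoc, Rinv_r, Rmult_1_l by lra.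
    eapply Rle_trans; [apply Hg|].
    apply (Rmult_le_reg_r (S y)); [easy|].
    unfold Rdiv. rewrite Rmult_assoc, Rinv_l, Rmult_1_r by (specialize (HS y); lra).
    eapply Rle_trans; [apply HgS|]. apply Rmult_le_compat_r; [left; easy|]. nra.
Qed.

(** * Drift of the range *)

Lemma gen_site m r q y : (1 <= q <= m)%nat ->
  gen m r (fun z => - INR (z q)) y = - r y q.
Proof.
  intros Hq. unfold gen.
  rewrite (lsum_update (sites m) (fun _ => 0)
    (fun j => r y j * (- INR (incr y j q) - - INR (y q))) q).
  - rewrite lsum_const, incr_same, S_INR. ring.
  - apply seq_NoDup.
  - now apply in_sites.
  - intros i Hi. rewrite incr_other by congruence. ring.
Qed.

Lemma rng_drift_bound Lam T T0 rho c u : 0 < Lam -> 0 < c ->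
  (u + 1) * Lam / c <= INR T0 -> (T0 <= T)%nat ->
  rho + u - INR T * (c / Lam) <= rho - 1.
Proof.
  intros HL Hc HT0 HT. apply le_INR in HT.
  assert (Hpos : 0 < c / Lam) by (apply Rdiv_lt_0_compat; lra).
  assert (u + 1 <= INR T * (c / Lam)); [|lra].
  apply Rle_trans with ((u + 1) * Lam / c * (c / Lam)).
  - right. field. lra.
  - apply Rmult_le_compat_r; lra.
Qed.

(* While the range is at least [L], either some site [j] stays low for [T] steps and splits
   the others into blocks of at most [n] sites, which grow slower than [b2], or the lowest
   site is an end site and grows at rate [b1]. *)
Lemma rng_drift_crystal b0 b1 b2 n k phi d C0 :
  0 < b0 -> b0 < b2 -> b2 < b1 -> (1 <= n)%nat -> (2 <= k <= n + 2)%nat ->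
  (forall x, INR (mx n x) <= phi x <= INR (mx n x) + C0) ->
  mono n phi -> (forall x j, phi (incr x j) <= phi x + 1) ->
  0 < d < b2 -> (forall x, gen n (rate b0 b1 b1 n) phi x <= d) ->
  exists T L : nat, (1 <= T)%nat /\ forall x, INR L <= rng k x ->
    iterk (unif b0 b1 b2 k) k (rate b0 b1 b2 k) T (rng k) x <= rng k x - 1.
Proof.
  intros H0 H02 H21 Hn Hk Hphi Hmono Hincr Hd Hdrift.
  set (Lam := unif b0 b1 b2 k). set (r := rate b0 b1 b2 k).
  assert (HU : uniformizable Lam k r) by (apply uniformizable_rate; lra || lia).
  assert (HL : 0 < Lam) by apply HU.
  assert (Hk1 : (1 <= k)%nat) by lia.
  set (eps := (b2 - d) / 4). assert (Heps : 0 < eps) by (unfold eps; lra).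
  destruct (blocks_upper_function b0 b1 b2 n phi d C0 eps) as (Cb & Hblocks); try easy; try lra.
  destruct (lower_function k b2 eps) as (D & Cl & low & Hlow & Hlowd); try easy; try lra.
  destruct (upper_function k b0 b1) as (eta & Cu & up & Heta & Hup & Hupd); try easy; try lra.
  destruct (INR_unbounded ((Cb + Cl + 1) * Lam / (2 * eps))) as (T1 & HT1).
  destruct (INR_unbounded ((Cu + 0 + 1) * Lam / eta)) as (T2 & HT2).
  (* One [T] serves both regimes. Range [2 * T] keeps a site from the lower half at or below [M],
     and a minimal site below all sites from the upper half; the extra [D] keeps a highest site [D]
     above the minimum. *)
  set (T := S (T1 + T2)). exists T, (D + 2 * T)%nat. split; [unfold T; lia|].
  intros x Hx. set (M := mx k x). set (m := mn k x).
  assert (HxL : (m + (D + 2 * T) <= M)%nat).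
  { unfold rng in Hx. apply INR_le. rewrite plus_INR. unfold m, M. lra. }
  assert (Hslow : forall gs, (1 <= length gs <= 2)%nat ->
    (forall y, reach T x y -> separated M k n gs y /\ covered M k gs y) ->
    iterk Lam k r T (rng k) x <= rng k x - 1).
  { intros gs Hlen Hgs. destruct (Hblocks M k gs Hlen) as (upb & Hb1 & Hb2 & Hb3).
    destruct (mx_attained k x Hk1) as (p & Hp & Hpx).
    eapply Rle_trans.
    - apply (rng_drift _ _ _ _ _ upb (low p) (d + eps) (b2 - eps) Cb Cl HU).
      + intros y Hy. destruct (Hgs y Hy) as [Hs Hc]. repeat split.
        * now apply Hb1.
        * now apply Hlow.
        * now apply Hb3.
        * apply Hlowd; [easy|apply HU|apply pushed_rate; lra|].
          destruct (mn_reach k T x y Hk1 Hy) as [_ Hmn]. specialize (Hy p).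
          fold m in Hmn. fold M in Hpx. lia.
      + apply Hb2; [|easy]. now apply Hgs, reach_refl.
      + now apply Hlow.
    - replace (b2 - eps - (d + eps)) with (2 * eps) by (unfold eps; lra).
      apply (rng_drift_bound Lam T T1); try lra. unfold T; lia. }
  (* A site that remains lowest gives the minimum exactly, hence the error 0, and its rate [b1]
     beats the maximum by [eta] whatever the size of the remaining block. *)
  assert (Hend : forall q, (1 <= q <= k)%nat ->
    (forall y, reach T x y -> r y q = b1 /\ mn k y = y q) ->
    iterk Lam k r T (rng k) x <= rng k x - 1).
  { intros q Hq H. eapply Rle_trans.
    - apply (rng_drift _ _ _ _ _ up (fun y => - INR (y q)) (b1 - eta) b1 Cu 0 HU).
      + intros y Hy. destruct (H y Hy) as [Hr Hm]. repeat split.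
        * apply Hup.
        * rewrite Hm. lra.
        * apply Hupd; [apply HU|apply capped_rate; lra].
        * rewrite gen_site by easy. lra.
      + apply Hup.
      + destruct (H x (reach_refl T x)) as [_ ->]. lra.
    - replace (b1 - (b1 - eta)) with eta by lra.
      apply (rng_drift_bound Lam T T2); try lra. unfold T; lia. }
  destruct (classic (exists j, (1 <= j <= k)%nat /\ (j - 1 <= n)%nat /\ (k - j <= n)%nat
                       /\ (2 * x j <= m + M)%nat)) as [(j & Hj & Hj1 & Hj2 & Hlowj)|Hno].
  { apply (Hslow ((0, j - 1) :: (j, k - j) :: nil)%nat); [simpl; lia|].
    intros y Hy. assert (Hyj : (y j <= M)%nat) by (specialize (Hy j); lia). split.
    - intros o l [E|[E|[]]]; injection E as <- <-; repeat split; try lia;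
        intros; replace (0 + (j - 1) + 1)%nat with j by lia; easy.
    - intros i Hi. destruct (Nat.lt_trichotomy i j) as [Hij|[->|Hij]]; [right|now left|right].
      + exists 0%nat, (j - 1)%nat. split; [now left|lia].
      + exists j, (k - j)%nat. split; [right; now left|lia]. }
  assert (Hhigh : forall j, (1 <= j <= k)%nat -> (j - 1 <= n)%nat -> (k - j <= n)%nat ->
                    (m + M < 2 * x j)%nat).
  { intros j Hj Hj1 Hj2. apply Nat.nle_gt. intros H. apply Hno. now exists j. }
  destruct (mn_attained k x Hk1) as (q & Hq & Hqm). fold m in Hqm.
  (* The lowest site is in the lower half, so [Hhigh] forces more than [n] sites on one side of it;
     with [k <= n + 2] only an end of a crystal of [n + 2] sites allows this. *)
  assert (Hkn : (k = n + 2)%nat /\ (q = 1 \/ q = k)%nat).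
  { destruct (Nat.le_gt_cases (q - 1) n) as [A|A], (Nat.le_gt_cases (k - q) n) as [B|B]; try lia.
    specialize (Hhigh q Hq A B). lia. }
  destruct Hkn as [Hkn Hq1k].
  (* If both ends are low, they enclose one block of exactly [n] sites; otherwise the end [q] is the
     only low site. *)
  destruct (classic (2 * x 1%nat <= m + M /\ 2 * x k <= m + M)%nat) as [[Hl1 Hlk]|Hnot].
  { apply (Hslow ((1, n) :: nil)%nat); [simpl; lia|].
    intros y Hy.
    assert (Hy1 : (y 1%nat <= M)%nat) by (specialize (Hy 1%nat); lia).
    assert (Hyk : (y k <= M)%nat) by (specialize (Hy k); lia). split.
    - intros o l [E|[]]; injection E as <- <-; repeat split; try lia;
        intros; replace (1 + n + 1)%nat with k by lia; easy.
    - intros i Hi. destruct (Nat.eq_dec i 1) as [->|]; [now left|].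
      destruct (Nat.eq_dec i k) as [->|]; [now left|].
      right. exists 1%nat, n. split; [now left|lia]. }
  assert (Hothers : forall i, (1 <= i <= k)%nat -> i <> q -> (m + M < 2 * x i)%nat).
  { intros i Hi Hiq.
    destruct (Nat.eq_dec i 1) as [->|]; [destruct Hq1k as [->|E]; [easy|rewrite <- E in Hnot; lia]|].
    destruct (Nat.eq_dec i k) as [->|]; [destruct Hq1k as [->|]; [lia|congruence]|].
    apply Hhigh; lia. }
  apply (Hend q Hq). intros y Hy.
  assert (Hyq : forall i, (1 <= i <= k)%nat -> i <> q -> (y q < y i)%nat).
  { intros i Hi Hiq. specialize (Hothers i Hi Hiq).
    pose proof (Hy i). pose proof (Hy q). lia. }
  split.
  - assert (HV : V k y q = 1%nat); [|unfold r, rate; now rewrite HV].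
    unfold V. rewrite (xb_in k y q Hq). destruct Hq1k as [->| ->].
    + rewrite xb_out by lia. rewrite xb_in by lia.
      pose proof (Hyq 2%nat ltac:(lia) ltac:(lia)) as H2. apply Nat.ltb_lt in H2.
      simpl Nat.add at 2. now rewrite H2.
    + rewrite (xb_out k y (k + 1)) by lia. rewrite xb_in by lia.
      pose proof (Hyq (k - 1)%nat ltac:(lia) ltac:(lia)) as H2. apply Nat.ltb_lt in H2.
      now rewrite H2.
  - apply Nat.le_antisymm; [now apply mn_lb|].
    destruct (mn_attained k y Hk1) as (i & Hi & <-).
    destruct (Nat.eq_dec i q) as [->|Hiq]; [easy|]. specialize (Hyq i Hi Hiq). lia.
Qed.

(** * Foster's criterion *)

Definition killed (F : config -> bool) (f : config -> R) (x : config) : R :=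
  if F x then 0 else f x.

(** With [tau >= 1] the first return time to [F], this is the expectation of [f (X_N)] on [tau > N].
    Killing acts after each step, so the start may lie in [F]. *)
Definition hitk Lam m r F N (f : config -> R) : config -> R :=
  Nat.iter N (fun g => kern Lam m r (killed F g)) f.

Lemma hitk_S Lam m r F N f :
  hitk Lam m r F (S N) f = kern Lam m r (killed F (hitk Lam m r F N f)).
Proof. easy. Qed.

Lemma hitk_add Lam m r F N N' f :
  hitk Lam m r F (N + N') f = hitk Lam m r F N (hitk Lam m r F N' f).
Proof. unfold hitk. now rewrite Nat.iter_add. Qed.

Lemma hitk_le Lam m r F N f g x : uniformizable Lam m r -> (forall y, f y <= g y) ->
  hitk Lam m r F N f x <= hitk Lam m r F N g x.
Proof.
  intros HU H. revert x; induction N as [|N IH]; intros x; [easy|].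
  rewrite !hitk_S. apply kern_le; [easy| |intros j _]; unfold killed; destruct (F _); easy || lra.
Qed.

Lemma hitk_affine Lam m r F N a f g :
  hitk Lam m r F N (fun x => a * f x + g x) =
  (fun x => a * hitk Lam m r F N f x + hitk Lam m r F N g x).
Proof.
  induction N as [|N IH]; [easy|].
  apply functional_extensionality; intros x. rewrite !hitk_S, IH.
  replace (killed F (fun x => a * hitk Lam m r F N f x + hitk Lam m r F N g x))
    with (fun x => a * killed F (hitk Lam m r F N f) x + killed F (hitk Lam m r F N g) x).
  - unfold kern. rewrite gen_plus, gen_scal. unfold Rdiv. ring.
  - apply functional_extensionality; intros y. unfold killed. destruct (F y); ring.
Qed.

Lemma hitk_zero Lam m r F N x : hitk Lam m r F N (fun _ => 0) x = 0.
Proof.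
  pose proof (hitk_affine Lam m r F N (-1) (fun _ => 0) (fun _ => 0)) as H.
  apply (f_equal (fun h => h x)) in H. cbv beta in H.
  replace (fun _ : config => -1 * 0 + 0) with (fun _ : config => 0) in H
    by (apply functional_extensionality; intros; ring).
  lra.
Qed.

Lemma hitk_nonneg Lam m r F N f x : uniformizable Lam m r -> (forall y, 0 <= f y) ->
  0 <= hitk Lam m r F N f x.
Proof. intros HU H. rewrite <- (hitk_zero Lam m r F N x). now apply hitk_le. Qed.

Lemma hitk_le_iterk Lam m r F N f x : uniformizable Lam m r -> (forall y, 0 <= f y) ->
  hitk Lam m r F N f x <= iterk Lam m r N f x.
Proof.
  intros HU H. revert x; induction N as [|N IH]; intros x; [apply Rle_refl|].
  rewrite hitk_S, iterk_S.
  apply kern_le; [easy| |intros j _]; unfold killed; destruct (F _); auto;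
    (eapply Rle_trans; [|apply IH]; now apply hitk_nonneg).
Qed.

Lemma hitk_one_le Lam m r F N x : uniformizable Lam m r -> hitk Lam m r F N (fun _ => 1) x <= 1.
Proof.
  intros HU. eapply Rle_trans; [apply hitk_le_iterk; [easy|intros; lra]|].
  rewrite iterk_const. lra.
Qed.

Lemma hitk_one_decreasing Lam m r F N N' x : uniformizable Lam m r -> (N <= N')%nat ->
  hitk Lam m r F N' (fun _ => 1) x <= hitk Lam m r F N (fun _ => 1) x.
Proof.
  intros HU HN. replace N' with (N + (N' - N))%nat by lia. rewrite hitk_add.
  apply hitk_le; [easy|]. intros y. now apply hitk_one_le.
Qed.

(* [E_x (min (tau, N))] for the return time [tau] to [F]. *)
Definition hitting_time Lam m r F N (x : config) : R :=
  lsum (seq 0 N) (fun i => hitk Lam m r F i (fun _ => 1) x).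

Lemma hitting_time_le Lam m r F N x : uniformizable Lam m r ->
  0 <= hitting_time Lam m r F N x <= INR N.
Proof.
  intros HU. split.
  - apply lsum_nonneg. intros i _. apply hitk_nonneg; [easy|intros; lra].
  - rewrite <- (Rmult_1_r (INR N)). rewrite <- (length_seq N 0) at 2.
    apply lsum_le_const. intros i _. now apply hitk_one_le.
Qed.

Lemma hitting_time_add Lam m r F T N x :
  hitting_time Lam m r F (T + N) x =
  hitting_time Lam m r F T x + hitk Lam m r F T (hitting_time Lam m r F N) x.
Proof.
  unfold hitting_time. rewrite seq_app, lsum_app. f_equal. simpl plus.
  induction N as [|N IH].
  - simpl. now rewrite hitk_zero.
  - rewrite !seq_S, lsum_app, IH. simpl.
    replace (fun y => lsum (seq 0 N ++ N :: nil) (fun i => hitk Lam m r F i (fun _ => 1) y))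
      with (fun y => 1 * lsum (seq 0 N) (fun i => hitk Lam m r F i (fun _ => 1) y)
                     + hitk Lam m r F N (fun _ => 1) y).
    + rewrite hitk_affine, <- hitk_add. ring.
    + apply functional_extensionality; intros y. rewrite lsum_app. simpl. ring.
Qed.

(** Strong induction on the truncation [N] keeps all expectations finite. For large [W], the [T]
    steps spent are repaid by the decrease of [INR T * W]; for small [W], the chance [p0] of having
    returned lowers the contribution of [A] by [A * p0]. *)
Lemma foster Lam m r F (W : config -> R) (T m0 : nat) (L p0 : R) :
  uniformizable Lam m r -> (1 <= T)%nat -> (1 <= m0)%nat -> 0 <= L -> 0 < p0 ->
  (forall x, 0 <= W x) ->
  (forall N x, iterk Lam m r N W x <= W x + INR N) ->
  (forall x, L <= W x -> iterk Lam m r T W x <= W x - 1) ->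
  (forall x, W x < L -> hitk Lam m r F m0 (fun _ => 1) x <= 1 - p0) ->
  exists A, forall N x, hitting_time Lam m r F N x <= INR T * W x + A.
Proof.
  intros HU HT Hm0 HL Hp0 HW HWN Hdrift Hsmall.
  assert (HT' : 1 <= INR T) by (change 1 with (INR 1); now apply le_INR).
  assert (Hm0' : 1 <= INR m0) by (change 1 with (INR 1); now apply le_INR).
  (* Bounds the cost of [m0] steps from a small [W]: the steps themselves and [INR T] times the
     expected [W] afterwards. [A] is taken so large that [A * p0] covers it. *)
  set (c := INR m0 + INR T * (L + INR m0)).
  assert (Hc : 0 < c / p0) by (apply Rdiv_lt_0_compat; [unfold c; nra|easy]).
  set (A := c / p0 + INR T + INR m0). exists A.
  assert (HA : c <= A * p0).
  { unfold A. replace c with (c / p0 * p0) at 1 by (field; lra).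
    apply Rmult_le_compat_r; lra. }
  assert (HTW : forall x, 0 <= INR T * W x) by (intros; apply Rmult_le_pos; auto; lra).
  assert (Hnn : forall y, 0 <= INR T * W y + A).
  { intros y. specialize (HTW y). unfold A. lra. }
  intros N. induction N as [N IH] using lt_wf_ind. intros x.
  destruct (Rle_lt_dec L (W x)) as [Hlarge|Hlow].
  - destruct (Nat.le_gt_cases N T) as [HN|HN].
    + pose proof (hitting_time_le Lam m r F N x HU) as H. apply le_INR in HN.
      specialize (HTW x). unfold A. lra.
    + replace N with (T + (N - T))%nat by lia. rewrite hitting_time_add.
      pose proof (hitting_time_le Lam m r F T x HU) as H1.
      assert (H2 : hitk Lam m r F T (hitting_time Lam m r F (N - T)) x
                   <= iterk Lam m r T (fun y => INR T * W y + (fun _ => 0) y + A) x).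
      { eapply Rle_trans; [|apply hitk_le_iterk; [easy|]].
        - apply hitk_le; [easy|]. intros y. rewrite Rplus_0_r. apply IH. lia.
        - intros y. rewrite Rplus_0_r. apply Hnn. }
      rewrite iterk_affine, iterk_const in H2. specialize (Hdrift x Hlarge). nra.
  - destruct (Nat.le_gt_cases N m0) as [HN|HN].
    + pose proof (hitting_time_le Lam m r F N x HU) as H. apply le_INR in HN.
      specialize (HTW x). unfold A. lra.
    + replace N with (m0 + (N - m0))%nat by lia. rewrite hitting_time_add.
      pose proof (hitting_time_le Lam m r F m0 x HU) as H1.
      assert (H2 : hitk Lam m r F m0 (hitting_time Lam m r F (N - m0)) x
                   <= hitk Lam m r F m0 (fun y => INR T * W y + (A * 1 + 0)) x).
      { apply hitk_le; [easy|]. intros y. rewrite Rmult_1_r, Rplus_0_r. apply IH. lia. }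
      rewrite (hitk_affine Lam m r F m0 (INR T) W (fun _ => A * 1 + 0)) in H2.
      rewrite (hitk_affine Lam m r F m0 A (fun _ => 1) (fun _ => 0)), hitk_zero in H2.
      pose proof (hitk_le_iterk Lam m r F m0 W x HU HW) as H3.
      specialize (HWN m0 x). specialize (Hsmall x Hlow).
      assert (H4 : INR T * hitk Lam m r F m0 W x <= INR T * (L + INR m0)).
      { apply Rmult_le_compat_l; lra. }
      assert (H5 : A * hitk Lam m r F m0 (fun _ => 1) x <= A * (1 - p0)).
      { apply Rmult_le_compat_l; [unfold A; lra|easy]. }
      specialize (HTW x). unfold c in HA. lra.
Qed.

(** * Reaching a flat shape from a bounded range *)

Fixpoint deficit (k M : nat) (x : config) : nat :=
  match k with 0%nat => 0%nat | S k' => (deficit k' M x + (M - x k))%nat end.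

Lemma deficit_pos k M x : (0 < deficit k M x)%nat -> exists j, (1 <= j <= k)%nat /\ (x j < M)%nat.
Proof.
  induction k as [|k IH]; simpl; [lia|]. intros H.
  destruct (Nat.lt_ge_cases (x (S k)) M) as [HM|HM].
  - exists (S k); lia.
  - destruct IH as (j & Hj & Hx); [lia|]. exists j; lia.
Qed.

Lemma deficit_zero k M x : deficit k M x = 0%nat -> forall j, (1 <= j <= k)%nat -> (M <= x j)%nat.
Proof.
  induction k as [|k IH]; simpl; [lia|]. intros H j Hj.
  destruct (Nat.eq_dec j (S k)) as [->|]; [lia|]. apply IH; lia.
Qed.

Lemma deficit_incr k M x j : (1 <= j)%nat -> (x j < M)%nat ->
  deficit k M x = (deficit k M (incr x j) + (if Nat.leb j k then 1 else 0))%nat.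
Proof.
  intros Hj HM. induction k as [|k IH].
  - destruct j; simpl; lia.
  - change (deficit (S k) M x) with (deficit k M x + (M - x (S k)))%nat.
    change (deficit (S k) M (incr x j)) with (deficit k M (incr x j) + (M - incr x j (S k)))%nat.
    rewrite IH. destruct (Nat.eq_dec j (S k)) as [->|E].
    + rewrite incr_same. rewrite Nat.leb_refl.
      destruct (Nat.leb_spec (S k) k); lia.
    + rewrite incr_other by congruence.
      destruct (Nat.leb_spec j k), (Nat.leb_spec j (S k)); lia.
Qed.

Lemma deficit_le k M x D : (forall j, (1 <= j <= k)%nat -> (M <= x j + D)%nat) ->
  (deficit k M x <= k * D)%nat.
Proof.
  induction k as [|k IH]; simpl; intros H; [lia|].
  pose proof (H (S k)). specialize (IH ltac:(intros; apply H; lia)). lia.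
Qed.

Lemma kern_one_site Lam m r g x j p q : uniformizable Lam m r -> (1 <= j <= m)%nat ->
  (forall y, g y <= 1) -> g (incr x j) <= 1 - q -> 0 <= q -> p <= r x j / Lam ->
  kern Lam m r g x <= 1 - p * q.
Proof.
  intros HU Hj Hg Hgj Hq Hp. pose proof HU as (HL & Hr & Ht).
  rewrite kern_weights by lra.
  set (w := fun i => r x i / Lam).
  assert (Hw : forall i, 0 <= w i) by (intros; apply Rle_mult_inv_pos; auto).
  assert (Hsum : lsum (sites m) w = lsum (sites m) (r x) / Lam).
  { unfold w, Rdiv. rewrite Rmult_comm, <- lsum_scal. apply lsum_ext; intros; ring. }
  rewrite <- Hsum.
  assert (Hw1 : lsum (sites m) w <= 1).
  { rewrite Hsum. specialize (Ht x). apply (Rmult_le_compat_r (/ Lam)) in Ht;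
      [|left; now apply Rinv_0_lt_compat]. rewrite Rinv_r in Ht by lra. exact Ht. }
  assert (H1 : (1 - lsum (sites m) w) * g x <= 1 - lsum (sites m) w).
  { specialize (Hg x). nra. }
  assert (H2 : lsum (sites m) (fun i => w i * g (incr x i)) <=
               lsum (sites m) (fun i => if Nat.eqb i j then w i * (1 - q) else w i)).
  { apply lsum_le. intros i _. specialize (Hw i). specialize (Hg (incr x i)).
    destruct (Nat.eqb_spec i j) as [->|]; [apply Rmult_le_compat_l; easy|nra]. }
  rewrite (lsum_update (sites m) w
    (fun i => if Nat.eqb i j then w i * (1 - q) else w i) j) in H2.
  - rewrite Nat.eqb_refl in H2.
    assert (p * q <= w j * q) by (apply Rmult_le_compat_r; easy).
    unfold w in *. lra.
  - apply seq_NoDup.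
  - now apply in_sites.
  - intros i Hi. now apply Nat.eqb_neq in Hi as ->.
Qed.

(** Each step can raise a site still below [M], with probability at least [p]; after as many such
    jumps as the deficit all sites are at [M]. An earlier flat shape is already a return and only
    helps. *)
Lemma hitk_flat Lam k r p M D x : uniformizable Lam k r -> 0 < p <= 1 ->
  (forall y j, p <= r y j / Lam) ->
  (forall j, (1 <= j <= k)%nat -> (x j <= M)%nat) -> deficit k M x = S D ->
  hitk Lam k r (flat k) (S D) (fun _ => 1) x <= 1 - p ^ S D.
Proof.
  intros HU Hp Hr. revert x; induction D as [|D IH]; intros x HM HD;
    destruct (deficit_pos k M x) as (j & Hj & Hxj); try lia;
    pose proof (deficit_incr k M x j (proj1 Hj) Hxj) as Hinc;
    rewrite (proj2 (Nat.leb_le j k) (proj2 Hj)) in Hinc;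
    assert (HM' : forall i, (1 <= i <= k)%nat -> (incr x j i <= M)%nat)
      by (intros i Hi; destruct (Nat.eq_dec i j) as [->|];
          [rewrite incr_same; lia|rewrite incr_other by easy; auto]);
    rewrite hitk_S, <- tech_pow_Rmult; apply (kern_one_site _ _ _ _ _ j); try easy.
  - intros y. unfold killed. destruct (flat k y); [lra|]. now apply hitk_one_le.
  - assert (Hflat : flat k (incr x j) = true).
    { apply forallb_forall. intros i Hi. apply in_seq in Hi.
      pose proof (deficit_zero k M (incr x j) ltac:(lia)) as Hz.
      pose proof (Hz i ltac:(lia)). pose proof (Hz (S i) ltac:(lia)).
      pose proof (HM' i ltac:(lia)). pose proof (HM' (S i) ltac:(lia)).
      apply Nat.eqb_eq. lia. }
    unfold killed. rewrite Hflat. simpl. lra.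
  - simpl; lra.
  - intros y. unfold killed. destruct (flat k y); [lra|]. now apply hitk_one_le.
  - unfold killed. destruct (flat k (incr x j)).
    + assert (p ^ S D <= 1); [|lra]. rewrite <- (pow1 (S D)). apply pow_incr. lra.
    + apply IH; [easy|lia].
  - apply pow_le; lra.
Qed.

Lemma dexp_survival b0 b1 b2 k N f : unif b0 b1 b2 k <> 0 ->
  dexp (Nat.iter N (kstep b0 b1 b2 k) ((1, zero_config) :: nil)) f =
  hitk (unif b0 b1 b2 k) k (rate b0 b1 b2 k) (flat k) N f zero_config.
Proof.
  intros HL. revert f; induction N as [|N IH]; intros f.
  - unfold dexp, hitk. simpl. ring.
  - change (Nat.iter (S N) (kstep b0 b1 b2 k) ((1, zero_config) :: nil))
      with (kstep b0 b1 b2 k (Nat.iter N (kstep b0 b1 b2 k) ((1, zero_config) :: nil))).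
    rewrite <- Nat.add_1_r, hitk_add, <- IH.
    change (hitk (unif b0 b1 b2 k) k (rate b0 b1 b2 k) (flat k) 1 f)
      with (kern (unif b0 b1 b2 k) k (rate b0 b1 b2 k) (killed (flat k) f)).
    rewrite <- dexp_ustep by easy. unfold dexp, kstep. rewrite lsum_filter.
    apply lsum_ext. intros [w y] _. unfold killed. simpl. destruct (flat k y); simpl; ring.
Qed.

Theorem theorem6 (b0 b1 b2 : R) (n : nat) :
  0 < b0 -> b0 < b2 -> b2 < b1 -> (1 <= n)%nat ->
  (exists l, is_glb (tilde_D n b0 b1) l /\ b2 > l) ->
  forall k : nat, (2 <= k <= n + 2)%nat -> shape_ergodic b0 b1 b2 k.
Proof.
  intros H0 H02 H21 Hn (l & [_ Hglb] & Hl) k Hk.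
  (* The infimum need not belong to the set, but lying below [b2] it leaves an element below
     [b2]. *)
  assert (Hd : exists d, tilde_D n b0 b1 d /\ d < b2).
  { apply NNPP. intros H. assert (b2 <= l); [|lra]. apply Hglb. intros d Hd.
    apply Rnot_lt_le. intros Hlt. apply H. now exists d. }
  destruct Hd as (d & HD & Hdb2).
  destruct (tilde_speed_reached b0 b1 b2 n d Hn) as (N0 & d' & HN0 & Hd' & Hspeed); [lra..|easy|].
  destruct (tilde_corrector b0 b1 n N0 d' Hn) as (phi & P1 & P2 & P3 & P4); [lra..|easy|easy|].
  destruct (rng_drift_crystal b0 b1 b2 n k phi d' (INR N0)) as (T & L & HT & Hdrift); try easy.
  set (Lam := unif b0 b1 b2 k) in *. set (r := rate b0 b1 b2 k) in *.
  assert (HU : uniformizable Lam k r) by (apply uniformizable_rate; lra || lia).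
  assert (HL : 0 < Lam) by apply HU.
  assert (Hk1 : (1 <= k)%nat) by lia.
  set (p := b0 / Lam).
  assert (Hr : forall y j, p <= r y j / Lam).
  { intros y j. apply Rmult_le_compat_r; [left; now apply Rinv_0_lt_compat|].
    apply rate_bounds; lra. }
  assert (Hp : 0 < p <= 1).
  { split; [apply Rdiv_lt_0_compat; lra|].
    apply (Rmult_le_reg_r Lam); [easy|]. unfold p, Rdiv.
    rewrite Rmult_assoc, Rinv_l, Rmult_1_l, Rmult_1_r by lra.
    unfold Lam, unif.
    assert (1 <= INR k) by (change 1 with (INR 1); now apply le_INR). nra. }
  (* A range below [L] leaves each site at most [S L] under the target height, which is one above
     the maximum. *)
  set (m0 := S (k * S L)).
  destruct (foster Lam k r (flat k) (rng k) T m0 (INR L) (p ^ m0) HU HT) as (A & HA).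
  - unfold m0; lia.
  - apply pos_INR.
  - apply pow_lt; lra.
  - intros x. now apply rng_nonneg.
  - intros N x. rewrite <- (iterk_const Lam k r N (rng k x + INR N) x).
    apply iterk_le; [easy|]. intros y Hy. now apply rng_reach.
  - exact Hdrift.
  - intros x Hx.
    (* One above the maximum, so that the deficit is positive even for flat [x]: a return takes at
       least one step. *)
    set (M := S (mx k x)).
    assert (Hrange : (mx k x < mn k x + L)%nat).
    { apply INR_lt. rewrite plus_INR. unfold rng in Hx. lra. }
    assert (Hle : (deficit k M x <= k * S L)%nat).
    { apply deficit_le. intros j Hj. pose proof (mn_lb k x j Hj). unfold M. lia. }
    destruct (deficit k M x) as [|D] eqn:E.
    { pose proof (deficit_zero k M x E 1%nat ltac:(lia)).
      pose proof (mx_ub k x 1%nat ltac:(lia)). unfold M in *. lia. }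
    apply Rle_trans with (hitk Lam k r (flat k) (S D) (fun _ => 1) x).
    + apply hitk_one_decreasing; [easy|]. unfold m0; lia.
    + eapply Rle_trans.
      * apply (hitk_flat Lam k r p M); try easy.
        intros j Hj. pose proof (mx_ub k x j Hj). unfold M; lia.
      * assert (p ^ m0 <= p ^ S D); [|lra].
        replace m0 with (S D + (m0 - S D))%nat by (unfold m0; lia).
        rewrite pow_add. rewrite <- (Rmult_1_r (p ^ S D)) at 2.
        apply Rmult_le_compat_l; [apply pow_le; lra|].
        rewrite <- (pow1 (m0 - S D)). apply pow_incr. lra.
  - assert (Hsv : forall i, survival b0 b1 b2 k i = hitk Lam k r (flat k) i (fun _ => 1) zero_config).
    { intros i. unfold survival, Lam, r. rewrite <- dexp_survival by (fold Lam; lra).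
      unfold total_mass, dexp, lsum. induction (Nat.iter i _ _) as [|q dd IH]; simpl; [easy|].
      rewrite IH. ring. }
    assert (Hsum : forall i, sum_f_R0 (survival b0 b1 b2 k) i =
                             hitting_time Lam k r (flat k) (S i) zero_config).
    { induction i as [|i IH].
      - unfold hitting_time. simpl. rewrite Hsv. symmetry. apply Rplus_0_r.
      - rewrite tech5, IH, Hsv. unfold hitting_time.
        rewrite (seq_S (S i)), lsum_app. f_equal. symmetry. apply Rplus_0_r. }
    (* The partial sums are expected truncated return times, increasing and bounded uniformly in the
       truncation. *)
    destruct (growing_cv (sum_f_R0 (survival b0 b1 b2 k))) as (s & Hs).
    + intros i. rewrite tech5, Hsv.
      pose proof (hitk_nonneg Lam k r (flat k) (S i) (fun _ => 1) zero_config HU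
        ltac:(intros; lra)). lra.
    + exists (INR T * rng k zero_config + A). intros v (i & ->). rewrite Hsum. apply HA.
    + exists s. exact Hs.
Qed.
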